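(* Let $\mu\ne0$, let $\tau_L(\varepsilon),\delta_L(\varepsilon),\tau_R(\varepsilon),\delta_R(\varepsilon)$ vary smoothly with a real parameter $\varepsilon$ near $0$, let $\mathcal{X},\mathcal{Y}$ be words on $\{L,R\}$ with $\mathcal{X}$ primitive and $\mathcal{X}_0\ne\mathcal{Y}_0$, and let $\mathcal{S}[k]=\mathcal{X}^k\mathcal{Y}$. Suppose that when $\varepsilon=0$ there exist infinitely many $k\ge1$ for which the border-collision normal form has a unique, admissible, stable $\mathcal{S}[k]$-cycle that has no points on the switching manifold, that $M_{\mathcal{X}}(0)$ has a repeated unit eigenvalue of geometric multiplicity $1$, that $\delta_L(0)=\delta_R(0)=1$, and that $$\min_i\left|x_i^{\mathcal{S}[k]}(0)\right|\to\infty\quad\text{as }k\to\infty.$$ Suppose $\beta<\alpha<0$, where $\alpha,\beta\in\mathbb{R}$ are defined by $\det(M_{\mathcal{X}}(\varepsilon))=1+\alpha\varepsilon+\mathcal{O}(\varepsilon^2)$ and $\mathrm{trace}(M_{\mathcal{X}}(\varepsilon))=2+\beta\varepsilon+\mathcal{O}(\varepsilon^2)$. For small $\varepsilon>0$ let $\kappa(\varepsilon)$ be the number of $\mathcal{S}[k]$-cycles that are admissible and attracting, and for a suitably small $\varepsilon^*>0$ and each positive integer $K$ let $$\varepsilon_K=\sup\{\varepsilon\in[0,\varepsilon^*]:\kappa(\varepsilon)=K\}.$$ Then (there is $\varepsilon^*>0$ such that) as $K\to\infty$, $$\varepsilon_K\sim\varphi(K)\,K^{-2},$$ for a function $\varphi(K)$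 that is bounded between positive constants.
   Context: For real $\tau_L,\delta_L,\tau_R,\delta_R,\mu$ set $A_J=\begin{bmatrix}\tau_J&1\\ -\delta_J&0\end{bmatrix}$ and $f^J(x,y)=A_J\begin{bmatrix}x\\ y\end{bmatrix}+\begin{bmatrix}\mu\\ 0\end{bmatrix}$ for $J\in\{L,R\}$. The border-collision normal form is the continuous map of $\mathbb{R}^2$ equal to $f^L$ for $x\le0$ and $f^R$ for $x\ge0$; the switching manifold is $x=0$. A word $\mathcal{S}=\mathcal{S}_0\cdots\mathcal{S}_{n-1}$ on $\{L,R\}$ is primitive if it is not a power of a shorter word; primitive words are identified with periodic symbol sequences of minimal period $n$. $\mathcal{X}^k\mathcal{Y}$ denotes concatenation of $k$ copies of $\mathcal{X}$ followed by $\mathcal{Y}$. Put $f^{\mathcal{S}}=f^{\mathcal{S}_{n-1}}\circ\cdots\circ f^{\mathcal{S}_0}$, an affine map with matrix part $M_{\mathcal{S}}=A_{\mathcal{S}_{n-1}}\cdots A_{\mathcal{S}_0}$. An $\mathcal{S}$-cycle consists of points $(x_i^{\mathcal{S}},y_i^{\mathcal{S}})$, $i=0,\dots,n-1$, with $(x_0^{\mathcal{S}},y_0^{\mathcal{S}})$ a fixed point of $f^{\mathcal{S}}$ and $(x_{i+1}^{\mathcal{S}},y_{i+1}^{\mathcal{S}})=f^{\mathcal{S}_i}(x_i^{\mathcal{S}},y_i^{\mathcal{S}})$. It is unique if and only if $1$ is not an eigenvalue of $M_{\mathcal{S}}$. It is admissible if $x_i^{\mathcal{S}}\le0$ whenever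 $\mathcal{S}_i=L$ and $x_i^{\mathcal{S}}\ge0$ whenever $\mathcal{S}_i=R$. It has no points on the switching manifold if $x_i^{\mathcal{S}}\neq0$ for all $i$. An admissible $\mathcal{S}$-cycle with no points on the switching manifold is stable if both eigenvalues of $M_{\mathcal{S}}$ have modulus $\le1$, and attracting if both have modulus $<1$. When the parameters depend on $\varepsilon$, so do all these objects. The notation $a_K\sim b_K$ means $a_K/b_K\to1$.
   Formalization: The limit K→∞ is taken only over those K that κ(ε) attains for some ε in [0,ε*], since for smooth parameters κ can skip arbitrarily large K and the supremum ε_K is then over an empty set; infinitely many K are proved to be attained. *)

(* Defs.v *)
From HB Require Import structures.
From mathcomp Require Import all_boot all_order all_algebra.
From mathcomp Require Import all_classical all_reals all_analysis.
From mathcomp Require Import complex.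

Set Implicit Arguments.
Unset Strict Implicit.
Unset Printing Implicit Defensive.

Import Order.TTheory GRing.Theory Num.Theory.
Import numFieldNormedType.Exports.

Local Open Scope classical_set_scope.
Local Open Scope ring_scope.

Inductive letter := L | R.

Definition word := seq letter.

(* A power of a shorter word is [W^m] with [size W < size X]; the empty word is
   not considered primitive. *)
Definition primitive (X : word) : Prop :=
  X <> [::] /\
  ~ exists (W : word) (m : nat), (size W < size X)%N /\ X = flatten (nseq m W).

(* [powcat X Y k] is X^k Y. *)
Definition powcat (X Y : word) (k : nat) : word := flatten (nseq k X) ++ Y.

(* X_0 <> Y_0; both words are nonempty, so that these letters exist. *)
Definition first_letters_differ (X Y : word) : Prop :=
  exists (a b : letter) (X' Y' : word), [/\ X = a :: X', Y = b :: Y' & a <> b].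

Record params (F : realType) := Params {
  tauL : F; deltaL : F; tauR : F; deltaR : F; mu : F }.

Section Defs.
Variable F : realType.
Implicit Types (p : params F) (S : word) (z : 'cV[F]_2) (e : F).

Definition tau p (J : letter) : F := if J is L then tauL p else tauR p.
Definition delta p (J : letter) : F := if J is L then deltaL p else deltaR p.

Definition Amx p (J : letter) : 'M[F]_2 := \matrix_(i, j)
  if i == 0 then (if j == 0 then tau p J else 1)
  else (if j == 0 then - delta p J else 0).

Definition affine_map p (J : letter) z : 'cV[F]_2 :=
  Amx p J *m z + mu p *: delta_mx 0 0.

(* The leftmost letter acts first. *)
Definition Mword p S : 'M[F]_2 := foldl (fun M J => Amx p J *m M) 1%:M S.
Definition fword p S z : 'cV[F]_2 := foldl (fun w J => affine_map p J w) z S.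

(* An S-cycle is encoded by its initial point; its i-th point is then obtained
   by applying the first i letters of S. *)
Definition is_cycle p S z : Prop := fword p S z = z.
Definition cycle_point p S z (i : nat) : 'cV[F]_2 := fword p (take i S) z.
Definition cycle_x p S z (i : nat) : F := cycle_point p S z i 0 0.

Definition unique_cycle p S z : Prop :=
  is_cycle p S z /\ forall z', is_cycle p S z' -> z' = z.

Definition admissible p S z : Prop := forall i, (i < size S)%N ->
  if nth L S i is L then cycle_x p S z i <= 0 else 0 <= cycle_x p S z i.

Definition off_switching p S z : Prop :=
  forall i, (i < size S)%N -> cycle_x p S z i != 0.

Definition eigenvalueC (M : 'M[F]_2) (l : F[i]) : Prop :=
  eigenvalue (map_mx (real_complex F) M) l.

Definition stable_cycle p S z : Prop :=
  [/\ is_cycle p S z, admissible p S z, off_switching p S z &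
      forall l, eigenvalueC (Mword p S) l -> `|l| <= 1].

Definition attracting_cycle p S z : Prop :=
  [/\ is_cycle p S z, admissible p S z, off_switching p S z &
      forall l, eigenvalueC (Mword p S) l -> `|l| < 1].

Definition smooth_near0 (g : F -> F) : Prop :=
  \forall e \near (0 : F), forall n : nat, derivable (derive1n n g) e 1.

(* [eigenspace] is the left eigenspace; its dimension is also that of the
   right one. *)
Definition repeated_unit_eigenvalue_geom1 (M : 'M[F]_2) : Prop :=
  char_poly M = ('X - 1%:P) ^+ 2 /\ \rank (eigenspace M 1) = 1%N.

(* Here S[k] = X^k Y; the tag k keeps S[k]-cycles for different k apart. *)
Definition attracting_cycles p (X Y : word) : set (nat * 'cV[F]_2) :=
  [set kz | (1 <= kz.1)%N /\ attracting_cycle p (powcat X Y kz.1) kz.2].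

(* kappa(e) = n, for the parameter family P.  As a relation, because the set
   of cycles is not known beforehand to be finite. *)
Definition kappa_is (P : F -> params F) (X Y : word) e (n : nat) : Prop :=
  (attracting_cycles (P e) X Y #= `I_n)%card.

Definition kappa_level (P : F -> params F) (X Y : word) (estar : F) (n : nat) :
    set F :=
  [set e | 0 <= e <= estar /\ kappa_is P X Y e n].

(* The indices n for which the supremum defining eps_n exists.  With smooth,
   non-analytic parameter dependence, kappa can skip arbitrarily large values:
   two cycles can disappear at exactly the same parameter value. *)
Definition eps_defined (P : F -> params F) (X Y : word) (estar : F) : set nat :=
  [set n | (1 <= n)%N /\ kappa_level P X Y estar n !=set0].

Definition eps (P : F -> params F) (X Y : word) (estar : F) (n : nat) : F :=
  sup (kappa_level P X Y estar n).

Definition asymp_equiv (D : set nat) (a b : nat -> F) : Prop :=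
  a n / b n @[n --> within D \oo] --> (1 : F).

End Defs.

(* Main.v *)
(* It suffices that the number of attracting cycles be of exact order e^(-1/2).

   At e = 0 write M_X = 1 + N with N^2 = 0. Since det M_S[k] = 1, stability for
   infinitely many k forces tr (M_Y N) = 0, and then uniqueness forces
   M_Y = -1 + b N, so that tr M_S[k] = -2 for all k. Hence all S[k]-cycles exist,
   their points at the ends of the X-part depend affinely on k, and x moves with
   constant acceleration along the X-part; divergence of min |x_i| makes all the
   leading coefficients nonzero, of the signs required by admissibility.

   For e > 0 the x-coordinates at times j |X| + r satisfy a second order linear
   recurrence with constant forcing, which rotates by an angle of order sqrt e.
   If k^2 e is large, then the orbit makes more than half a turn, during which x
   cannot keep the sign opposite to the acceleration: no cycle is admissible.
   If k is large and k^2 e is small, then the leading coefficients at the ends of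
   the X-part are close to those for e = 0, a maximum principle extends the signs
   to the whole orbit, and the Jury conditions hold because
   1 + tr + det ~ (alpha - beta) k^2 e and 1 - det ~ - alpha k e. *)

Require Import Defs.
From HB Require Import structures.
From mathcomp Require Import all_boot all_order all_algebra.
From mathcomp Require Import all_classical all_reals all_analysis.
From mathcomp Require Import complex ring lra.

Set Implicit Arguments.
Unset Strict Implicit.
Unset Printing Implicit Defensive.

Import Order.TTheory GRing.Theory Num.Theory.
Import numFieldNormedType.Exports.

Local Open Scope classical_set_scope.
Local Open Scope ring_scope.

(** * Powers of planar matrices *)

(** At e = 0 the matrix M_X is a shear, so its eigenvectors degenerate as e tends to 0 and
    diagonalisation would be singular in the limit. Powers of M_X are therefore expanded in the
    basis 1, M_X - 1, with coefficients polynomial in s = det (1 - M_X) and d = det M_X; at s = 0, d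
    = 1 they become 1 and k without any singularity. Both s and 1 - d are of exact order e.

    The relevant k grow like e^(-1/2), so expansions in e for fixed k are useless: the estimates
    have to be uniform in k and e jointly, and are stated as limits along a filter on pairs (k, e).

    The intermediate range, where k^2 e is of order one, is left undecided; it changes the number of
    attracting cycles by a bounded factor only. The outcome is that kappa(e) = n puts n^2 e between
    two positive constants. This holds at every point of a level set of kappa, hence also for its
    supremum, however irregular the level set is. *)

Section PowerCoefficients.
Variable F : realFieldType.
Implicit Types s d g : F.

(* If [s = 1 - tr M + det M] and [d = det M] for a 2x2 matrix [M], then
   [M ^ k = coefV s d k + coefU s d k * (M - 1)]. *)
Fixpoint powcoef s d (k : nat) : F * F :=
  if k is k'.+1 then
    let vu := powcoef s d k' in (vu.1 - s * vu.2, vu.1 - s * vu.2 + d * vu.2)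
  else (1, 0).

Definition coefV s d k := (powcoef s d k).1.
Definition coefU s d k := (powcoef s d k).2.
Definition sumU s d k := \sum_(j < k) coefU s d j.
(** The sum of the [coefV s d j] over j < k (see [sumVS]): by the recurrences, V_j = (U_{j+1} - U_j)
    + (s + 1 - d) U_j, and the first part telescopes. *)
Definition sumV s d k := coefU s d k + (s + 1 - d) * sumU s d k.

Lemma coefV0 s d : coefV s d 0 = 1. Proof. by []. Qed.
Lemma coefU0 s d : coefU s d 0 = 0. Proof. by []. Qed.
Lemma coefU1 s d : coefU s d 1 = 1.
Proof. by rewrite /coefU /=; ring. Qed.
Lemma coefVS s d k : coefV s d k.+1 = coefV s d k - s * coefU s d k.
Proof. by []. Qed.
Lemma coefUS s d k : coefU s d k.+1 = coefV s d k.+1 + d * coefU s d k.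
Proof. by []. Qed.
Lemma coefUSS s d k :
  coefU s d k.+2 = (1 + d - s) * coefU s d k.+1 - d * coefU s d k.
Proof. by rewrite coefUS coefVS [in RHS]coefUS [coefU s d k.+1]coefUS; ring. Qed.

Lemma sumU0 s d : sumU s d 0 = 0. Proof. by rewrite /sumU big_ord0. Qed.
Lemma sumUS s d k : sumU s d k.+1 = sumU s d k + coefU s d k.
Proof. by rewrite /sumU big_ord_recr. Qed.

Lemma mul_sumU s d k : s * sumU s d k = 1 - coefV s d k.
Proof.
elim: k => [|k IH]; first by rewrite sumU0 coefV0; ring.
by rewrite sumUS coefVS mulrDr IH; ring.
Qed.

Lemma sumVS s d k : sumV s d k.+1 = sumV s d k + coefV s d k.
Proof.
have -> : coefV s d k = 1 - s * sumU s d k by rewrite mul_sumU; ring.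
have -> : sumV s d k.+1 = coefV s d k - s * coefU s d k + d * coefU s d k
    + (s + 1 - d) * (sumU s d k + coefU s d k) by rewrite -sumUS.
have -> : coefV s d k = 1 - s * sumU s d k by rewrite mul_sumU; ring.
by rewrite /sumV; ring.
Qed.

Lemma sumUSS s d k :
  sumU s d k.+2 = (1 + d - s) * sumU s d k.+1 - d * sumU s d k + 1.
Proof.
elim: k => [|k IH]; first by rewrite !sumUS sumU0 coefU0 coefU1; ring.
rewrite [LHS]sumUS [in LHS]IH coefUSS [sumU s d k.+2]sumUS.
by rewrite [sumU s d k.+1]sumUS; ring.
Qed.

(** Both sides are det (M ^ k): with N = M - 1, the trace of N is d - s - 1 and its determinant is
    s. *)
Lemma det_powcoef s d k :
  coefV s d k ^+ 2 + (d - s - 1) * coefU s d k * coefV s d k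
    + s * coefU s d k ^+ 2 = d ^+ k.
Proof.
elim: k => [|k IH]; first by rewrite coefV0 coefU0 expr0; ring.
by rewrite [RHS]exprS -IH coefUS coefVS; ring.
Qed.

(* The cancellation that makes the S[k]-cycle points O(k) rather than O(k^2). *)
Lemma sumU_cancel s d k :
  s * (sumU s d k * (1 + coefV s d k) - coefU s d k * sumV s d k)
  = 1 - d ^+ k + (d - s - 1) * coefU s d k.
Proof.
rewrite -(det_powcoef s) /sumV.
rewrite mulrBr mulrA mul_sumU.
have -> : s * (coefU s d k * (coefU s d k + (s + 1 - d) * sumU s d k)) =
  s * coefU s d k ^+ 2 + (s + 1 - d) * coefU s d k * (s * sumU s d k) by ring.
by rewrite mul_sumU; ring.
Qed.

Lemma coef00 k : (coefV 0 1 k = 1 :> F) * (coefU 0 1 k = k%:R :> F).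
Proof.
elim: k => [|k [IHV IHU]]; first by [].
have hV : coefV 0 1 k.+1 = 1 :> F by rewrite coefVS IHV mul0r subr0.
by rewrite coefUS hV IHU mul1r -nat1r.
Qed.

(** The reference values are 1 and k, attained at s = 0, d = 1. One step lowers V by at most s k,
    and s k^2 + s k <= s (k + 1)^2 closes the induction. *)
Lemma coef_bounds s d k : 0 <= s -> 0 <= d <= 1 -> s * k%:R ^+ 2 <= 1 ->
  [/\ 1 - s * k%:R ^+ 2 <= coefV s d k, coefV s d k <= 1,
      0 <= coefU s d k, coefU s d k <= k%:R &
      k%:R * (1 - s * k%:R ^+ 2 - (1 - d) * k%:R) <= coefU s d k].
Proof.
move=> s0 /andP[d0 d1].
elim: k => [_|k IH]; first by rewrite coefV0 coefU0; split; lra.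
rewrite -natr1; set K : F := k%:R => hk.
have K0 : 0 <= K by rewrite ler0n.
have sK0 : 0 <= s * K by rewrite mulr_ge0.
have [|V1 V2 U0 U1 U2] := IH; first by rewrite -/K; nra.
rewrite coefUS coefVS.
rewrite -/K in V1 V2 U0 U1 U2.
set V := coefV s d k in V1 V2 *; set U := coefU s d k in U0 U1 U2 *.
have sU : s * U <= s * K by rewrite ler_wpM2l.
have sU0 : 0 <= s * U by rewrite mulr_ge0.
have dU0 : 0 <= d * U by rewrite mulr_ge0.
have dU : d * U <= U by rewrite -[leRHS]mul1r ler_wpM2r.
have eU : (1 - d) * U <= (1 - d) * K by rewrite ler_wpM2l // subr_ge0.
have eK : 0 <= (1 - d) * K by rewrite mulr_ge0 // subr_ge0.
split; [nra|nra|nra|nra|].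
have -> : d * U = U - (1 - d) * U by ring.
nra.
Qed.

(** Variation of constants from an arbitrary starting index i: [coefU] solves the homogeneous
    recurrence and [sumU] the one with forcing 1. The order two of the recurrence requires an
    induction on two consecutive indices. *)
Lemma coef_rec_formula s d g (w : nat -> F) :
  (forall j, w j.+2 = (1 + d - s) * w j.+1 - d * w j - g) ->
  forall i m, w (i + m.+1)%N
    = coefU s d m.+1 * w i.+1 - d * coefU s d m * w i
      - g * sumU s d m.+1.
Proof.
move=> hw i m.
suff [] : (w (i + m.+1)%N = coefU s d m.+1 * w i.+1 - d * coefU s d m * w i
      - g * sumU s d m.+1) /\
    (w (i + m.+2)%N = coefU s d m.+2 * w i.+1 - d * coefU s d m.+1 * w i
      - g * sumU s d m.+2) by [].
elim: m => [|m [IH1 IH2]].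
  rewrite addn1 addn2 hw !sumUS sumU0 coefUSS coefU1 coefU0.
  by split; ring.
split=> //.
rewrite !addnS hw -!addnS IH1 IH2 (coefUSS _ _ m.+1) (coefUSS _ _ m).
by rewrite (sumUSS _ _ m.+1); ring.
Qed.

End PowerCoefficients.

(** * Planar matrices and iterates of affine maps *)

Section Entries2.
Variable R : comNzRingType.
Implicit Types A : 'M[R]_2.

Lemma ord2_cases (i : 'I_2) : i = 0 \/ i = 1.
Proof. by case: i => [[|[|//]] ?]; [left|right]; apply: val_inj. Qed.

Lemma mulmx2E n A (B : 'M[R]_(2, n)) i j :
  (A *m B) i j = A i 0 * B 0 j + A i 1 * B 1 j.
Proof.
rewrite mxE big_ord_recl big_ord_recl big_ord0 addr0.
by congr (_ * _ + A i _ * B _ j); apply: val_inj.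
Qed.

Lemma det2E A : \det A = A 0 0 * A 1 1 - A 0 1 * A 1 0.
Proof.
rewrite (expand_det_row _ ord0) big_ord_recl big_ord_recl big_ord0.
rewrite /cofactor !det_mx11 !mxE /= addr0 expr0 expr1 mul1r mulN1r mulrN.
by congr (A _ _ * A _ _ - A _ _ * A _ _); apply: val_inj.
Qed.

Lemma tr2E A : \tr A = A 0 0 + A 1 1.
Proof.
rewrite /mxtrace big_ord_recl big_ord_recl big_ord0 addr0.
by congr (_ + A _ _); apply: val_inj.
Qed.

Lemma char_poly2 A : char_poly A = 'X^2 - \tr A *: 'X + (\det A)%:P.
Proof.
apply/polyP => i; rewrite [in RHS]coefD [in RHS]coefB coefXn coefZ coefX coefC.
case: i => [|[|[|i]]] /=.
- by rewrite char_poly_det sqrrN expr1n mul1r mulr0 subr0 add0r.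
- by rewrite (@char_poly_trace _ 2) // mulr1 sub0r addr0.
- rewrite mulr0 subr0 addr0; have /monicP := char_poly_monic A.
  by rewrite /lead_coef size_char_poly.
- by rewrite nth_default ?size_char_poly // mulr0 subr0 addr0.
Qed.

End Entries2.

Section PlanarMatrices.
Variable F : realFieldType.
Implicit Types (A B M : 'M[F]_2) (z p q : 'cV[F]_2).

Lemma eq_mx2 A B : A 0 0 = B 0 0 -> A 0 1 = B 0 1 -> A 1 0 = B 1 0 ->
  A 1 1 = B 1 1 -> A = B.
Proof.
move=> h00 h01 h10 h11; apply/matrixP => i j.
by case: (ord2_cases i) => ->; case: (ord2_cases j) => ->.
Qed.

(** The adjugate of a 2x2 matrix. It is linear in A and polynomial in the entries, so it replaces
    the inverse without any side condition. *)
Definition adj2 A : 'M[F]_2 := (\tr A)%:M - A.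

Lemma adj2E A : (adj2 A 0 0 = A 1 1) * (adj2 A 0 1 = - A 0 1) *
  (adj2 A 1 0 = - A 1 0) * (adj2 A 1 1 = A 0 0).
Proof. by rewrite /adj2 !mxE tr2E !eqxx /=; split; [split;[split|]|]; ring. Qed.

Lemma sub1_sqr M : (M - 1%:M) *m (M - 1%:M)
  = (\tr M - 2) *: (M - 1%:M) - (1 - \tr M + \det M) *: 1%:M.
Proof.
by apply: eq_mx2; rewrite !mulmx2E !mxE !tr2E !det2E /=; ring.
Qed.

Lemma sub1_sqr_mul M z : (M - 1%:M) *m ((M - 1%:M) *m z)
  = (\tr M - 2) *: ((M - 1%:M) *m z) - (1 - \tr M + \det M) *: z.
Proof. by rewrite mulmxA sub1_sqr mulmxBl -!scalemxAl mul1mx. Qed.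

Lemma adj2_mul A : adj2 A *m A = (\det A)%:M.
Proof.
by apply: eq_mx2; rewrite !mulmx2E !mxE !tr2E !det2E /=; ring.
Qed.

(** Cayley-Hamilton for an affine map. The last term does not depend on z, so every linear
    functional of the orbit satisfies a second order recurrence with constant forcing. *)
Lemma affine_second_iterate M p z : M *m (M *m z + p) + p =
  \tr M *: (M *m z + p) - \det M *: z + (p - adj2 M *m p).
Proof.
have h x : M *m x = \tr M *: x - adj2 M *m x.
  by rewrite /adj2 mulmxBl mul_scalar_mx opprB addrC subrK.
rewrite [M *m (_ + _)]h [adj2 M *m (_ + _)]mulmxDr mulmxA adj2_mul.
by rewrite mul_scalar_mx opprD -!addrA; congr (_ + (_ + _)); rewrite addrC.
Qed.

Lemma sub1_adj2 A :
  (1%:M - A) *m (1%:M - adj2 A) = (1 - \tr A + \det A)%:M.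
Proof.
by apply: eq_mx2; rewrite !mulmx2E !mxE !tr2E !det2E /=; ring.
Qed.

Lemma det_sub1 A : \det (1%:M - A) = 1 - \tr A + \det A.
Proof. by rewrite !det2E tr2E !mxE /=; ring. Qed.

Section Iterates.
Variables (M : 'M[F]_2) (p : 'cV[F]_2).
Let s := 1 - \tr M + \det M.
Let d := \det M.
Let N := M - 1%:M.
Let V := coefV s d.
Let U := coefU s d.
Let sV := sumV s d.
Let sU := sumU s d.

Let trM2 : \tr M - 2 = d - s - 1. Proof. by rewrite /s /d; ring. Qed.

Lemma iter_affine k z : iter k (fun z => M *m z + p) z
  = V k *: z + U k *: (N *m z) + sV k *: p + sU k *: (N *m p).
Proof.
elim: k => [|k IH].
  rewrite /= /V /U /sV /sumV /sU sumU0 coefU0 coefV0.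
  by rewrite mulr0 addr0 !scale0r scale1r !addr0.
rewrite iterS IH; set x := (X in M *m X).
have -> : M *m x + p = x + N *m x + p by rewrite /N mulmxBl mul1mx [x + _]addrC subrK.
have -> : N *m x = V k *: (N *m z) + U k *: ((d - s - 1) *: (N *m z) - s *: z)
   + sV k *: (N *m p) + sU k *: ((d - s - 1) *: (N *m p) - s *: p).
  by rewrite /x !mulmxDr -!scalemxAr /N !sub1_sqr_mul -/N -/s trM2.
rewrite /x; move: (N *m z) (N *m p) => z1 p1.
rewrite {}/x /V coefVS /U coefUS coefVS /sV sumVS /sU sumUS.
have hV : s * sumU s d k = 1 - coefV s d k by rewrite mul_sumU.
apply/matrixP => i j; rewrite !mxE.
rewrite /sumV.
have -> : coefV s d k = 1 - s * sumU s d k by rewrite hV; ring.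
ring.
Qed.

Definition powV k := V k *: 1%:M + U k *: N.

Lemma det_powV k : \det (powV k) = d ^+ k.
Proof.
rewrite -(det_powcoef s) -/(U k) -/(V k) /powV det2E !mxE /= /s /d tr2E det2E.
ring.
Qed.

Lemma adj2_powV k : adj2 (powV k) = (V k + (d - s - 1) * U k) *: 1%:M - U k *: N.
Proof.
by apply: eq_mx2; rewrite !mxE !tr2E !mxE /= /s /d tr2E; ring.
Qed.

End Iterates.

Lemma adj2M A B : adj2 (A *m B) = adj2 B *m adj2 A.
Proof.
by apply: eq_mx2; rewrite !mulmx2E !adj2E !mulmx2E; ring.
Qed.

End PlanarMatrices.

(** * Words, their affine maps, and orbits along X^k Y *)

Section Words.
Variable F : realType.
Implicit Types (pr : params F) (S X Y W : word) (z : 'cV[F]_2).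

Definition sgl (J : letter) : F := if J is L then -1 else 1.

Lemma fword_cat pr S W z : fword pr (S ++ W) z = fword pr W (fword pr S z).
Proof. exact: foldl_cat. Qed.

Lemma Mword_foldl pr S (B : 'M[F]_2) :
  foldl (fun M J => Amx pr J *m M) B S = Mword pr S *m B.
Proof.
rewrite /Mword; elim/last_ind: S => [|S J IH]; first by rewrite mul1mx.
by rewrite !foldl_rcons IH mulmxA.
Qed.

Lemma Mword_cat pr S W : Mword pr (S ++ W) = Mword pr W *m Mword pr S.
Proof. by rewrite {1}/Mword foldl_cat Mword_foldl. Qed.

Lemma Mword_rcons pr S J : Mword pr (rcons S J) = Amx pr J *m Mword pr S.
Proof. exact: foldl_rcons. Qed.

Lemma fword_rcons pr S J z :
  fword pr (rcons S J) z = Amx pr J *m fword pr S z + mu pr *: delta_mx 0 0.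
Proof. exact: foldl_rcons. Qed.

Lemma fword_affine pr S z : fword pr S z = Mword pr S *m z + fword pr S 0.
Proof.
elim/last_ind: S => [|S J IH]; first by rewrite mul1mx addr0.
by rewrite !fword_rcons Mword_rcons IH mulmxDr mulmxA addrA.
Qed.

Lemma fword_nseq pr X k z :
  fword pr (flatten (nseq k X)) z
    = iter k (fun z => Mword pr X *m z + fword pr X 0) z.
Proof.
elim: k z => [//|k IH] z.
by rewrite iterSr -[X in iter k _ X]fword_affine /= fword_cat IH.
Qed.

Lemma Mword_nseq pr X k :
  Mword pr (flatten (nseq k X)) = powV (Mword pr X) k.
Proof.
elim: k => [|k IH].
  by rewrite /powV coefV0 coefU0 scale0r addr0 scale1r.
rewrite /= Mword_cat IH.
set M := Mword pr X; rewrite /powV.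
set s := 1 - \tr M + \det M; set d := \det M.
rewrite -[X in _ *m X](subrK 1%:M M) mulmxDr mulmx1 mulmxDl -!scalemxAl mul1mx.
rewrite sub1_sqr -/s -/d coefUS coefVS.
have -> : \tr M - 2 = d - s - 1 by rewrite /s /d; ring.
move: (M - 1%:M) => N.
by apply/matrixP => i j; rewrite !mxE; ring.
Qed.

Lemma size_nseq_flatten X k : size (flatten (nseq k X)) = (k * size X)%N.
Proof. by rewrite size_flatten /shape map_nseq sumn_nseq mulnC. Qed.

Lemma take_powcat_l X Y k j r : (j < k)%N -> (r <= size X)%N ->
  take (j * size X + r) (powcat X Y k) = flatten (nseq j X) ++ take r X.
Proof.
move=> jk rX; rewrite /powcat -(subnKC jk) addSnnS nseqD flatten_cat /= -!catA take_cat size_nseq_flatten.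
rewrite ltnNge leq_addr /= addKn; congr (_ ++ _).
by rewrite take_cat; case: ltngtP rX => // -> _; rewrite subnn take0 cats0 take_size.
Qed.

Lemma nth_powcat_l X Y k j r : (j < k)%N -> (r < size X)%N ->
  nth L (powcat X Y k) (j * size X + r) = nth L X r.
Proof.
move=> jk rX; rewrite /powcat -(subnKC jk) addSnnS nseqD flatten_cat /= -!catA.
by rewrite nth_cat size_nseq_flatten ltnNge leq_addr /= addKn nth_cat rX.
Qed.

Lemma take_powcat_r X Y k r :
  take (k * size X + r) (powcat X Y k) = flatten (nseq k X) ++ take r Y.
Proof.
by rewrite /powcat take_cat size_nseq_flatten ltnNge leq_addr /= addKn.
Qed.

Lemma nth_powcat_r X Y k r :
  nth L (powcat X Y k) (k * size X + r) = nth L Y r.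
Proof.
by rewrite /powcat nth_cat size_nseq_flatten ltnNge leq_addr /= addKn.
Qed.

Lemma size_powcat X Y k : size (powcat X Y k) = (k * size X + size Y)%N.
Proof. by rewrite size_cat size_nseq_flatten. Qed.

Lemma powcat_forall X Y k (Q : nat -> Prop) : (0 < size X)%N ->
  (forall i, (i < size (powcat X Y k))%N -> Q i) <->
  (forall j r, (j < k)%N -> (r < size X)%N -> Q (j * size X + r)%N) /\
  (forall r, (r < size Y)%N -> Q (k * size X + r)%N).
Proof.
move=> X0; rewrite size_powcat; split=> [h|[hl hr] i hi].
  split=> [j r jk rX|r rY]; apply: h; last by rewrite ltn_add2l.
  rewrite ltn_addr //; apply: (@leq_trans (j.+1 * size X)).
    by rewrite mulSn addnC ltn_add2r.
  by rewrite leq_mul2r jk orbT.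
have [ik|ik] := ltnP i (k * size X).
  rewrite (divn_eq i (size X)); apply: hl; last by rewrite ltn_mod.
  by rewrite ltn_divLR.
by rewrite -(subnKC ik); apply: hr; rewrite ltn_subLR.
Qed.

Lemma admissible_strictP pr S z :
  admissible pr S z /\ off_switching pr S z <->
  forall i, (i < size S)%N -> 0 < sgl (nth L S i) * cycle_x pr S z i.
Proof.
split=> [[ha ho] i iS|h].
  have := ha i iS; have := ho i iS; rewrite /sgl.
  case: (nth L S i) => h1 h2; rewrite ?mulN1r ?mul1r ?oppr_gt0 lt_neqAle.
    by rewrite h1.
  by rewrite eq_sym h1.
split=> i iS; have := h i iS; rewrite /sgl; case: (nth L S i);
  rewrite ?mulN1r ?mul1r ?oppr_gt0.
- exact: ltW.
- exact: ltW.
- by move/ltr0_neq0.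
- by move/lt0r_neq0.
Qed.

Definition xword pr W z : F := fword pr W z 0 0.

(** For fixed r, the times j |X| + r all carry the same letter, so admissibility asks one sign of
    the sequence in j obtained by iterating the single affine map of X. *)
Lemma strict_powcatP pr X Y k z : (0 < size X)%N ->
  let g := fun z => Mword pr X *m z + fword pr X 0 in
  (admissible pr (powcat X Y k) z /\ off_switching pr (powcat X Y k) z) <->
  (forall j r, (j < k)%N -> (r < size X)%N ->
     0 < sgl (nth L X r) * xword pr (take r X) (iter j g z)) /\
  (forall r, (r < size Y)%N ->
     0 < sgl (nth L Y r) * xword pr (take r Y) (iter k g z)).
Proof.
move=> X0 g; rewrite admissible_strictP powcat_forall //.
rewrite /cycle_x /cycle_point /xword; split=> -[hl hr]; split.
- move=> j r jk rX; have := hl j r jk rX.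
  by rewrite nth_powcat_l// take_powcat_l ?(ltnW rX)// fword_cat fword_nseq.
- move=> r rY; have := hr r rY.
  by rewrite nth_powcat_r take_powcat_r fword_cat fword_nseq.
- move=> j r jk rX; have := hl j r jk rX.
  by rewrite nth_powcat_l// take_powcat_l ?(ltnW rX)// fword_cat fword_nseq.
- move=> r rY; have := hr r rY.
  by rewrite nth_powcat_r take_powcat_r fword_cat fword_nseq.
Qed.

Lemma cycle_x_powcat pr X Y k z (B : F) : (0 < size X)%N ->
  let g := fun z => Mword pr X *m z + fword pr X 0 in
  (forall i, (i < size (powcat X Y k))%N ->
     B <= `|cycle_x pr (powcat X Y k) z i|) ->
  (forall j r, (j < k)%N -> (r < size X)%N ->
     B <= `|xword pr (take r X) (iter j g z)|) /\
  (forall r, (r < size Y)%N -> B <= `|xword pr (take r Y) (iter k g z)|).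
Proof.
move=> X0 g; rewrite powcat_forall // /cycle_x /cycle_point /xword => -[hl hr].
split=> [j r jk rX|r rY].
  have := hl j r jk rX.
  by rewrite take_powcat_l ?(ltnW rX)// fword_cat fword_nseq.
by have := hr r rY; rewrite take_powcat_r fword_cat fword_nseq.
Qed.

Lemma is_cycle_powcat pr X Y k z :
  let g := fun z => Mword pr X *m z + fword pr X 0 in
  is_cycle pr (powcat X Y k) z <->
  Mword pr Y *m iter k g z + fword pr Y 0 = z.
Proof. by move=> g; rewrite /is_cycle fword_cat fword_nseq fword_affine. Qed.

Lemma Mword_powcat pr X Y k :
  Mword pr (powcat X Y k) = Mword pr Y *m powV (Mword pr X) k.
Proof. by rewrite Mword_cat Mword_nseq. Qed.

Lemma det_Mword1 pr S : deltaL pr = 1 -> deltaR pr = 1 -> \det (Mword pr S) = 1.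
Proof.
move=> hL hR; elim/last_ind: S => [|S J IH]; first by rewrite det1.
rewrite Mword_rcons det_mulmx IH mulr1 det2E !mxE /=.
by case: J; rewrite /= ?hL ?hR; ring.
Qed.

End Words.

(** * Planar eigenvalues and uniqueness of cycles *)

Section Eigenvalues.
Variable F : realType.
Implicit Types (A : 'M[F]_2).
Local Open Scope complex_scope.

Lemma eigenvalueC2 A (l : F[i]) :
  eigenvalueC A l <-> l ^+ 2 - (\tr A)%:C * l + (\det A)%:C = 0.
Proof.
rewrite /eigenvalueC eigenvalue_root_char char_poly2 /root !hornerE.
rewrite det_map_mx -(trace_map_mx (real_complex F)).
by split=> [/eqP|->].
Qed.

Lemma jury_criterion A : \det A < 1 -> 0 < 1 - \tr A + \det A -> 0 < 1 + \tr A + \det A ->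
  forall l, eigenvalueC A l -> `|l| < 1.
Proof.
move: (\tr A) (\det A) (eigenvalueC2 A) => t d hA d1 h1 h2 [x y] /hA.
rewrite expr2 => /eqP; rewrite eq_complex => /andP[/eqP /= h3 /eqP /= h4].
rewrite normc_def -[1]/(1%:C) ltcR /= -[1]sqrtr1 ltr_sqrt //.
(* The imaginary part of the characteristic equation. Either the root is real, or 2 x = t and the
   real part says that the squared modulus is d. *)
have : y * (2 * x - t) = 0 by nra.
move/eqP; rewrite mulf_eq0 => /orP[/eqP y0|/eqP h5].
  rewrite y0 in h3 *.
  have h : x ^+ 2 - t * x + d = 0 by nra.
  have [x1|x1] := ltP 1 x; first by nra.
  have [x2|x2] := ltP x (-1); first by nra.
  have [e|e] := eqVneq x 1; first by rewrite e in h; nra.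
  have [e'|e'] := eqVneq x (-1); first by rewrite e' in h; nra.
  have x3 : x < 1 by rewrite lt_neqAle e x1.
  have x4 : -1 < x by rewrite lt_neqAle eq_sym e' x2.
  nra.
nra.
Qed.

Lemma eigenvalueC_pair A : exists l1 l2 : F[i],
  [/\ eigenvalueC A l1, eigenvalueC A l2, l1 + l2 = (\tr A)%:C &
      l1 * l2 = (\det A)%:C].
Proof.
have [r hr] := closed_field_poly_normal (char_poly (map_mx (real_complex F) A)).
have h1 : lead_coef (char_poly (map_mx (real_complex F) A)) = 1.
  exact/monicP/char_poly_monic.
rewrite h1 scale1r in hr.
have : size r = 2%N.
  by apply: succn_inj; rewrite -(size_prod_XsubC _ id) -hr size_char_poly.
case: r hr => [|x [|y [|]]] //; rewrite !big_cons big_nil mulr1 => hr _.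
exists x, y; have hx : root (char_poly (map_mx (real_complex F) A)) x.
  by rewrite hr rootM root_XsubC eqxx.
have hy : root (char_poly (map_mx (real_complex F) A)) y.
  by rewrite hr rootM !root_XsubC eqxx orbT.
have e : ('X - x%:P) * ('X - y%:P) = 'X^2 - (x + y) *: 'X + (x * y)%:P.
  by rewrite polyCM scalerDl -!mul_polyC; ring.
move: hr; rewrite e char_poly2 => /polyP hr.
have := hr 0%N; have := hr 1%N; rewrite !coefE /=.
rewrite !mulr1 !mulr0 !sub0r !addr0 !oppr0 !add0r => /oppr_inj ht hd.
split; rewrite ?/eigenvalueC ?eigenvalue_root_char //.
- by rewrite -ht trace_map_mx.
- by rewrite -hd det_map_mx.
Qed.

Lemma eigenvalueC_le1_tr A :
  (forall l, eigenvalueC A l -> `|l| <= 1) -> -2 <= \tr A <= 2.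
Proof.
have [l1 [l2 [h1 h2 ht _]]] := eigenvalueC_pair A.
move=> h; have : `|(\tr A)%:C| <= 2.
  by rewrite -ht (le_trans (ler_normD _ _)) // -[2]/(1 + 1) lerD ?h.
rewrite normc_def /= expr0n addr0 sqrtr_sqr -[2]/(1 + 1) -[1]/(1%:C).
by rewrite -(raddfD (real_complex F)) lecR -[1 + 1]/2 ler_norml.
Qed.

Lemma eigenvalueC_lt1_det A :
  (forall l, eigenvalueC A l -> `|l| < 1) -> \det A < 1.
Proof.
have [l1 [l2 [h1 h2 _ hd]]] := eigenvalueC_pair A.
move=> h; have : `|(\det A)%:C| < 1.
  by rewrite -hd normrM mulr_ilt1 ?h.
rewrite normc_def /= expr0n addr0 sqrtr_sqr -[1]/(1%:C).
by rewrite ltcR; apply: le_lt_trans; rewrite ler_norm.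
Qed.

Lemma eigenvalueC_lt1_sub A :
  (forall l, eigenvalueC A l -> `|l| < 1) -> 1 - \tr A + \det A != 0.
Proof.
move=> h; apply/eqP => h0; have : `|1 : F[i]| < 1.
  apply: h; apply/eigenvalueC2; rewrite expr1n mulr1 -[1]/(1%:C).
  by rewrite -(raddfB (real_complex F)) -(raddfD (real_complex F)) h0.
by rewrite normr1 ltxx.
Qed.

End Eigenvalues.

Section Cycles.
Variable F : realType.
Implicit Types (pr : params F) (S : word) (z : 'cV[F]_2).

Lemma is_cycleE pr S z :
  is_cycle pr S z <-> (1%:M - Mword pr S) *m z = fword pr S 0.
Proof.
rewrite /is_cycle fword_affine mulmxBl mul1mx.
by split=> [/(canRL (addKr _))|/eqP]; [rewrite addrC => ->|rewrite subr_eq addrC => /eqP].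
Qed.

Lemma is_cycle_uniq pr S z z' : 1 - \tr (Mword pr S) + \det (Mword pr S) != 0 ->
  is_cycle pr S z -> is_cycle pr S z' -> z = z'.
Proof.
rewrite -det_sub1 -unitfE -[_ \is a _]/(1%:M - Mword pr S \in unitmx) => u.
by move=> /is_cycleE h /is_cycleE h'; apply: (can_inj (mulKmx u)); rewrite h h'.
Qed.

Lemma cycle_solution pr S (D := 1 - \tr (Mword pr S) + \det (Mword pr S)) :
  D != 0 ->
  is_cycle pr S (D^-1 *: ((1%:M - adj2 (Mword pr S)) *m fword pr S 0)).
Proof.
move=> D0; apply/is_cycleE.
by rewrite -scalemxAr mulmxA sub1_adj2 -/D mul_scalar_mx scalerA mulVf ?scale1r.
Qed.

Lemma unique_cycle_det pr S z : unique_cycle pr S z ->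
  1 - \tr (Mword pr S) + \det (Mword pr S) != 0.
Proof.
move=> [hz hu]; apply/negP => /eqP h0.
(* [det0P] yields a row vector in the left kernel, hence the transpose. Translating the cycle by the
   kernel vector gives a second cycle. *)
have : \det (1%:M - Mword pr S)^T == 0 by rewrite det_tr det_sub1 h0.
move=> /det0P[v v0 hv]; have hv' : (1%:M - Mword pr S) *m v^T = 0.
  by apply: trmx_inj; rewrite trmx_mul trmxK hv trmx0.
have : z + v^T = z.
  by apply: hu; apply/is_cycleE; rewrite mulmxDr hv' addr0; apply/is_cycleE.
move/eqP; rewrite -subr_eq0 addrC addKr => /eqP hv0.
by move/eqP: v0; apply; apply: trmx_inj; rewrite hv0 trmx0.
Qed.

End Cycles.

(** * The scalar recurrence satisfied by the x-coordinates *)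

Section Window.
Variable F : realType.
Implicit Types s d g : F.

Lemma sin_le_id (x : F) : 0 <= x -> sin x <= x.
Proof.
rewrite le_eqVlt => /orP[/eqP<-|x0]; first by rewrite sin0.
have [c _] := @MVT _ (@sin F) (@cos F) 0 x x0
  (fun y _ => is_derive_sin y) (continuous_subspaceT (@continuous_sin F)).
rewrite sin0 !subr0 => ->; rewrite ler_piMl ?(ltW x0) //; exact: cos_le1.
Qed.

(* [coefU s d k] is [r ^ (k - 1) sin (k th) / sin th] with [r ^ 2 = d] and
   [2 r cos th = 1 + d - s], so it changes sign after half a period. *)
Lemma coefU_le0 s d : 0 < d -> (1 + d - s) ^+ 2 < 4 * d ->
  exists J : nat, [/\ (0 < J)%N, coefU s d J <= 0 &
    J%:R <= pi / Num.sqrt (1 - (1 + d - s) ^+ 2 / (4 * d)) + 1].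
Proof.
move=> d0 ht; set t := 1 + d - s in ht *.
pose r := Num.sqrt d; have r0 : 0 < r by rewrite sqrtr_gt0.
have r2 : r ^+ 2 = d by rewrite sqr_sqrtr // ltW.
pose c := t / (2 * r).
have c2 : c ^+ 2 = t ^+ 2 / (4 * d).
  by rewrite /c -r2; field; rewrite gt_eqF.
have c21 : c ^+ 2 < 1 by rewrite c2 ltr_pdivrMr ?mul1r // mulr_gt0.
have c1 : -1 < c < 1 by apply/andP; split; nra.
have c1' : -1 <= c <= 1 by move/andP: c1 => [a b]; rewrite !ltW.
pose th := acos c.
have th0 : 0 < th by apply: acos_gt0; move/andP: c1 => [/ltW -> ->].
have thpi : th < pi by apply: acos_ltpi; move/andP: c1 => [-> /ltW ->].
have cth : cos th = c by rewrite acosK // in_itv.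
have sth : sin th = Num.sqrt (1 - c ^+ 2) by rewrite sin_acos.
have sth0 : 0 < sin th by rewrite sin_gt0_pi // th0.
have hU k : coefU s d k * (r * sin th) = r ^+ k * sin (k%:R * th).
  suff [] : coefU s d k * (r * sin th) = r ^+ k * sin (k%:R * th) /\
    coefU s d k.+1 * (r * sin th) = r ^+ k.+1 * sin (k.+1%:R * th) by [].
  elim: k => [|k [IH1 IH2]].
    by rewrite coefU0 coefU1 !mul0r sin0 mulr0 !mul1r expr1.
  split=> //; rewrite coefUSS -/t mulrBl -mulrA IH2 -mulrA IH1.
  have -> : t = 2 * r * cos th by rewrite cth /c; field; rewrite gt_eqF.
  rewrite -r2 -(natr1 k.+1) -(natr1 k) !mulrDl !mul1r.
  set a := k%:R * th; rewrite -addrA !sinD !cosD !exprS.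
  have h : sin th ^+ 2 = 1 - cos th ^+ 2 by rewrite -(cos2Dsin2 th); ring.
  by ring: h.
(* The first integer with J th > pi. Since J th <= pi + th < 2 pi, the sine is not positive there;
   [sin_le_id] then turns pi / th into the stated bound pi / sin th. *)
pose J := (Num.truncn (pi / th)).+1.
have /andP[J1 J2] : (Num.truncn (pi / th))%:R <= pi / th < J%:R.
  by rewrite truncn_itv // divr_ge0 ?pi_ge0 // ltW.
have J3 : pi < J%:R * th by rewrite -ltr_pdivrMr.
have J4 : J%:R * th <= pi + th.
  by rewrite /J -natr1 mulrDl mul1r lerD2r -ler_pdivlMr.
exists J; split=> //.
  rewrite -(pmulr_lle0 _ (mulr_gt0 r0 sth0)) hU.
  rewrite pmulr_rle0 ?exprn_gt0 // -[_ * th](subrK pi) sinDpi oppr_le0.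
  by apply: sin_ge0_pi; rewrite subr_ge0 (ltW J3) /=; lra.
rewrite /J -natr1 lerD2r (le_trans J1) // ler_pM2l ?pi_gt0 //.
by rewrite lef_pV2 ?posrE // -?c2 -sth // sin_le_id // ltW.
Qed.

(* Over half a period, x cannot keep one sign while its constant forcing has the
   opposite one, whatever the initial values are. *)
Lemma window_bound s d g (w : nat -> F) (k J : nat) : 0 <= d -> 0 < g ->
  (forall j, w j.+2 = (1 + d - s) * w j.+1 - d * w j - g) ->
  (forall j, (j < k)%N -> 0 <= w j) ->
  (0 < J)%N -> coefU s d J <= 0 -> (k <= J)%N.
Proof.
move=> d0 g0 hw wk J0 UJ.
(* At the least positive index m + 2 with U <= 0, all three terms of the solution formula started at
   index 0 are nonpositive and the forcing term is negative, so w is negative there. *)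
have [] := @ex_minnP (fun j => (0 < j)%N && (coefU s d j <= 0)).
  by exists J; rewrite J0.
move=> [|[|m]] /andP[//]; first by rewrite coefU1 ler10.
move=> _ Um hm; apply: (@leq_trans m.+2); last by apply: hm; rewrite J0.
rewrite leqNgt; apply/negP => mk.
have Upos l : (0 < l <= m.+1)%N -> 0 < coefU s d l.
  move=> /andP[l0 lm]; rewrite ltNge; apply/negP => Ul.
  by have := hm l; rewrite l0 Ul => /(_ isT); rewrite ltnNge lm.
have S0 : 0 < sumU s d m.+2.
  rewrite sumUS; apply: ltr_wpDl; last by rewrite Upos /=.
  rewrite /sumU; apply: sumr_ge0 => -[[|l] lm] _ /=; first by rewrite coefU0.
  by rewrite ltW // Upos //= ltnW.
have := wk _ mk; rewrite leNgt => /negP; apply.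
rewrite -[m.+2]add0n (coef_rec_formula hw).
have h1 : coefU s d m.+2 * w 1 <= 0 by rewrite mulr_le0_ge0 // wk // (leq_trans _ mk).
have h2 : 0 <= d * coefU s d m.+1 * w 0.
  by rewrite mulr_ge0 ?mulr_ge0 ?(ltW (Upos _ _)) ?leqnn // wk // (leq_trans _ mk).
have h3 : 0 < g * sumU s d m.+2 by rewrite mulr_gt0.
lra.
Qed.

(* A discrete maximum principle on windows shorter than half a period. *)
Lemma window_pos s d g (w : nat -> F) (k : nat) : 0 < d -> 0 <= g ->
  (forall j, w j.+2 = (1 + d - s) * w j.+1 - d * w j - g) ->
  (forall j, (0 < j <= k)%N -> 0 < coefU s d j) ->
  0 < w 0 -> 0 < w k -> forall j, (j <= k)%N -> 0 < w j.
Proof.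
move=> d0 g0 hw Upos w0 wk j jk; rewrite ltNge; apply/negP => wj.
(* The solution formula is restarted at the first index i + 1 where w fails to be positive: from w i
   > 0 and w (i + 1) <= 0 it gives w k <= 0. *)
have [] := @ex_minnP (fun j => (w j <= 0)); first by exists j.
move=> [|i] wi hi; first by rewrite leNgt w0 in wi.
have wi' : 0 < w i by rewrite ltNge; apply/negP => /hi; rewrite ltnn.
have ik : (i.+1 <= k)%N by rewrite (leq_trans (hi j wj)).
have := wk; rewrite ltNge => /negP; apply.
rewrite -(subnKC ik) addSnnS.
case: (k - i.+1)%N (subnKC ik) => [|m] e.
  by rewrite addn1.
have S0 : 0 <= sumU s d m.+2.
  rewrite /sumU; apply: sumr_ge0 => -[[|l] lm] _ /=; first by rewrite coefU0.
  by rewrite ltW // Upos //= -e addSn ltnW // ltnS (leq_trans _ (leq_addl _ _)).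
rewrite (coef_rec_formula hw).
have U1 : 0 < coefU s d m.+2 by rewrite Upos //= -e addSnnS leq_addl.
have U2 : 0 < coefU s d m.+1.
  by rewrite Upos //= -e (leq_trans _ (leq_addl _ _)).
have h1 : coefU s d m.+2 * w i.+1 <= 0 by rewrite mulr_ge0_le0 // ltW.
have h2 : 0 <= d * coefU s d m.+1 * w i by rewrite !mulr_ge0 // ltW.
have h3 : 0 <= g * sumU s d m.+2 by rewrite mulr_ge0.
lra.
Qed.

End Window.

(** * Limits as k grows and k^2 e tends to 0 *)

Section LargeK.
Variable F : realType.

(* The regime [k -> oo], [k ^ 2 e -> 0+] of pairs [(k, e)]. *)
Definition largek : set_system (nat * F) :=
  [set A | exists (k0 : nat) (c : F), 0 < c /\ forall k e,
     (k0 <= k)%N -> 0 < e -> k%:R ^+ 2 * e <= c -> A (k, e)].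

Global Instance largek_filter : Filter largek.
Proof.
split.
- by exists 0%N, 1; split.
- move=> A B [k1 [c1 [c10 h1]]] [k2 [c2 [c20 h2]]].
  exists (maxn k1 k2), (Num.min c1 c2); split; first by rewrite lt_min c10.
  move=> k e; rewrite geq_max le_min => /andP[? ?] ? /andP[? ?].
  by split; [apply: h1|apply: h2].
- move=> A B AB [k1 [c1 [c10 h1]]]; exists k1, c1; split => // k e ? ? ?.
  exact/AB/h1.
Qed.

Lemma largek_pos : \forall x \near largek, 0 < x.1%:R :> F /\ 0 < x.2.
Proof. by exists 1%N, 1; split => //= k e k0 e0 _; rewrite ltr0n. Qed.

(** Limits below are found by rewriting a quantity as a combination of factors with known limits.
    Such rewritings divide by k and by e, so the identity is only asked where both are positive. *)
Lemma cvg_largek_eq (f g : nat * F -> F) (l : F) :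
  (forall x, 0 < x.1%:R :> F -> 0 < x.2 -> f x = g x) ->
  g x @[x --> largek] --> l -> f x @[x --> largek] --> l.
Proof.
move=> fg; apply: cvg_trans; apply: near_eq_cvg.
by apply: filterS largek_pos => x [k0 e0]; rewrite fg.
Qed.

Lemma largek_k2e : x.1%:R ^+ 2 * x.2 @[x --> largek] --> (0 : F).
Proof.
apply/cvgrPdist_le => /= r r0; exists 0%N, r; split=> // k e _ e0 he.
by rewrite sub0r normrN ger0_norm // mulr_ge0 ?exprn_ge0 // ltW.
Qed.

Lemma largek_kV : x.1%:R^-1 @[x --> largek] --> (0 : F).
Proof.
apply/cvgrPdist_le => /= r r0; exists (Num.truncn r^-1).+1, 1; split=> //.
move=> k e hk _ _ /=; rewrite sub0r normrN ger0_norm ?invr_ge0 ?ler0n //.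
have r10 : 0 <= r^-1 by rewrite invr_ge0 ltW.
have /andP[_ h] := truncn_itv r10.
have k0 : 0 < k%:R :> F by rewrite ltr0n (leq_trans _ hk).
rewrite -[leRHS]invrK lef_pV2 ?posrE ?invr_gt0 //.
by rewrite (le_trans (ltW h)) // ler_nat.
Qed.

Lemma largek_ke : x.1%:R * x.2 @[x --> largek] --> (0 : F).
Proof.
apply: (@cvg_largek_eq _ (fun x => x.1%:R^-1 * (x.1%:R ^+ 2 * x.2))).
  by move=> [k e] /= k0 _; field; rewrite gt_eqF.
rewrite -[X in _ --> X](mulr0 (0 : F)).
exact: cvgM largek_kV largek_k2e.
Qed.

Lemma largek_e : x.2 @[x --> largek] --> (0 : F).
Proof.
apply: (@cvg_largek_eq _ (fun x => x.1%:R^-1 * (x.1%:R * x.2))).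
  by move=> [k e] /= k0 _; field; rewrite gt_eqF.
rewrite -[X in _ --> X](mulr0 (0 : F)).
exact: cvgM largek_kV largek_ke.
Qed.

Lemma cvg_largek_comp (f : F -> F) (l : F) :
  f e @[e --> 0^'] --> l -> f x.2 @[x --> largek] --> l.
Proof.
apply: cvg_comp => A [r /= r0 hr].
have /cvgrPdist_lt/(_ _ r0) h := largek_e.
near=> x; apply: hr => /=; last by rewrite gt_eqF //; near: x; apply: filterS largek_pos => ? [].
by near: x.
Unshelve. all: by end_near. Qed.

Section PowerLimits.
Variables (s d : F -> F) (a b : F).
Hypotheses (a0 : 0 < a) (b0 : 0 < b).
Hypotheses (hs : s e / e @[e --> 0^'] --> a) (hd : (1 - d e) / e @[e --> 0^'] --> b).

Let S (x : nat * F) := s x.2.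
Let D (x : nat * F) := d x.2.
Let U (x : nat * F) := coefU (S x) (D x) x.1.
Let V (x : nat * F) := coefV (S x) (D x) x.1.

Lemma largek_sk2 : S x * x.1%:R ^+ 2 @[x --> largek] --> (0 : F).
Proof.
apply: (@cvg_largek_eq _ (fun x => (s x.2 / x.2) * (x.1%:R ^+ 2 * x.2))).
  by move=> [k e] /= k0 e0; rewrite /S /=; field; rewrite gt_eqF.
rewrite -[X in _ --> X](mulr0 a).
exact: cvgM (cvg_largek_comp hs) largek_k2e.
Qed.

Lemma largek_dk : (1 - D x) * x.1%:R @[x --> largek] --> (0 : F).
Proof.
apply: (@cvg_largek_eq _ (fun x => ((1 - d x.2) / x.2) * (x.1%:R * x.2))).
  by move=> [k e] /= k0 e0; rewrite /D /=; field; rewrite gt_eqF.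
rewrite -[X in _ --> X](mulr0 b).
exact: cvgM (cvg_largek_comp hd) largek_ke.
Qed.

Lemma largek_sd : \forall x \near largek, [/\ 0 < x.1%:R :> F, 0 < x.2, 0 < S x,
  0 < D x < 1 & S x * x.1%:R ^+ 2 <= 1].
Proof.
have /cvgrPdist_lt/(_ _ a0) h1 := cvg_largek_comp hs.
have /cvgrPdist_lt/(_ _ b0) h2 := cvg_largek_comp hd.
have /cvgrPdist_lt/(_ _ ltr01) h3 := largek_sk2.
have /cvgrPdist_lt/(_ _ ltr01) h4 := largek_dk.
near=> x.
have [k0 e0] : 0 < x.1%:R :> F /\ 0 < x.2 by near: x; exact: largek_pos.
have k1 : 1 <= x.1%:R :> F by move: k0; rewrite ltr0n ler1n.
have s1 : `|a - s x.2 / x.2| < a by near: x.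
have s2 : `|b - (1 - d x.2) / x.2| < b by near: x.
have s3 : `|0 - S x * x.1%:R ^+ 2| < 1 by near: x.
have s4 : `|0 - (1 - D x) * x.1%:R| < 1 by near: x.
rewrite -/(S x) in s1; rewrite -/(D x) in s2.
have s0 : 0 < S x / x.2 by move: s1; rewrite ltr_norml => /andP[_]; lra.
have d0 : 0 < (1 - D x) / x.2 by move: s2; rewrite ltr_norml => /andP[_]; lra.
have s0' : 0 < S x by move: s0; rewrite pmulr_lgt0 ?invr_gt0.
have d0' : 0 < 1 - D x by move: d0; rewrite pmulr_lgt0 ?invr_gt0.
split=> //.
  move: s4; rewrite sub0r normrN ltr_norml => /andP[_ s4].
  by apply/andP; split; nra.
by move: s3; rewrite sub0r normrN ltr_norml => /andP[_ /ltW].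
Unshelve. all: by end_near. Qed.

Let eta (x : nat * F) := S x * x.1%:R ^+ 2 + (1 - D x) * x.1%:R.

Let cvg_eta : eta x @[x --> largek] --> (0 : F).
Proof. by rewrite -[X in _ --> X](addr0 (0 : F)); exact: cvgD largek_sk2 largek_dk. Qed.

(** The relative error depends on (k, e) but not on j <= k. This uniformity permits summation over j
    in [cvg_sumU] and keeps [coefU] positive on the whole window in [attracting_exists]. *)
Lemma coef_bounds_unif x j : (j <= x.1)%N -> 0 < S x -> 0 < D x < 1 ->
  S x * x.1%:R ^+ 2 <= 1 ->
  [/\ 1 - S x * x.1%:R ^+ 2 <= coefV (S x) (D x) j, coefV (S x) (D x) j <= 1,
   j%:R * (1 - eta x) <= coefU (S x) (D x) j & coefU (S x) (D x) j <= j%:R].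
Proof.
move=> jk s0 /andP[d0 d1] sk.
have j0 : 0 <= j%:R :> F by rewrite ler0n.
have jk' : j%:R <= x.1%:R :> F by rewrite ler_nat.
have sj : S x * j%:R ^+ 2 <= S x * x.1%:R ^+ 2.
  by apply: ler_wpM2l; [exact: ltW|rewrite ler_pXn2r ?nnegrE].
have dj : (1 - D x) * j%:R <= (1 - D x) * x.1%:R by apply: ler_wpM2l; rewrite // subr_ge0 ltW.
have [|||V1 V2 U0 U1 U2] := @coef_bounds F (S x) (D x) j.
- exact: ltW.
- by rewrite !ltW.
- exact: le_trans sk.
split=> //; first by apply: le_trans V1; rewrite lerD2l lerN2.
apply: le_trans U2; rewrite ler_wpM2l // /eta; lra.
Qed.

Lemma cvg_coefV : V x @[x --> largek] --> (1 : F).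
Proof.
apply: (@squeeze_cvgr _ _ _ _ (fun x => 1 - S x * x.1%:R ^+ 2) (fun=> 1)).
- near=> x; have [k0 e0 s0 d01 sk] : [/\ 0 < x.1%:R :> F, 0 < x.2, 0 < S x,
    0 < D x < 1 & S x * x.1%:R ^+ 2 <= 1] by near: x; exact: largek_sd.
  by have [-> -> _ _] := coef_bounds_unif (leqnn x.1) s0 d01 sk.
- rewrite -[X in _ --> X](subr0 (1 : F)); apply: cvgB largek_sk2; exact: cvg_cst.
- exact: cvg_cst.
Unshelve. all: by end_near. Qed.

Lemma cvg_coefU : U x / x.1%:R @[x --> largek] --> (1 : F).
Proof.
apply: (@squeeze_cvgr _ _ _ _ (fun x => 1 - eta x) (fun=> 1)).
- near=> x; have [k0 e0 s0 d01 sk] : [/\ 0 < x.1%:R :> F, 0 < x.2, 0 < S x,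
    0 < D x < 1 & S x * x.1%:R ^+ 2 <= 1] by near: x; exact: largek_sd.
  have [_ _ h1 h2] := coef_bounds_unif (leqnn x.1) s0 d01 sk.
  by rewrite ler_pdivlMr // ler_pdivrMr // mul1r h2 mulrC h1.
- rewrite -[X in _ --> X](subr0 (1 : F)); apply: cvgB cvg_eta; exact: cvg_cst.
- exact: cvg_cst.
Unshelve. all: by end_near. Qed.

Lemma cvg_sumU : sumU (S x) (D x) x.1 / x.1%:R ^+ 2 @[x --> largek] --> (2^-1 : F).
Proof.
have hk : (1 - x.1%:R^-1) / 2 @[x --> largek] --> (2^-1 : F).
  rewrite [X in _ --> X](_ : 2^-1 = (1 - 0) * 2^-1 :> F); last by ring.
  by apply: cvgM; [apply: cvgB largek_kV|]; exact: cvg_cst.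
apply: (@squeeze_cvgr _ _ _ _ (fun x => (1 - eta x) * ((1 - x.1%:R^-1) / 2))
  (fun x => (1 - x.1%:R^-1) / 2)) (hk).
- near=> x; have [k0 e0 s0 d01 sk] : [/\ 0 < x.1%:R :> F, 0 < x.2, 0 < S x,
    0 < D x < 1 & S x * x.1%:R ^+ 2 <= 1] by near: x; exact: largek_sd.
  have h k : (k <= x.1)%N ->
      (1 - eta x) * (k%:R * (k%:R - 1)) <= 2 * sumU (S x) (D x) k <= k%:R * (k%:R - 1).
    elim: k => [_|k IH kx]; first by rewrite sumU0 !mul0r !mulr0 lexx.
    have /andP[IH1 IH2] := IH (ltnW kx).
    have [_ _ h1 h2] := coef_bounds_unif (ltnW kx) s0 d01 sk.
    by rewrite sumUS -natr1; apply/andP; split; nra.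
  have /andP[h1 h2] := h _ (leqnn x.1).
  have k2 : 0 < x.1%:R ^+ 2 :> F by rewrite exprn_gt0.
  rewrite ler_pdivlMr // ler_pdivrMr //.
  have e : (1 - x.1%:R^-1) / 2 * x.1%:R ^+ 2 = x.1%:R * (x.1%:R - 1) / 2 :> F.
    by field; rewrite gt_eqF.
  by rewrite -mulrA e; apply/andP; split; lra.
- rewrite [X in _ --> X](_ : 2^-1 = (1 - 0) * 2^-1 :> F); last by ring.
  by apply: cvgM hk; apply: cvgB cvg_eta; exact: cvg_cst.
Unshelve. all: by end_near. Qed.

Lemma cvg_sumV : sumV (S x) (D x) x.1 / x.1%:R @[x --> largek] --> (1 : F).
Proof.
apply: (@cvg_largek_eq _ (fun x => U x / x.1%:R + (s x.2 / x.2 + (1 - d x.2) / x.2)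
    * (x.1%:R * x.2) * (sumU (S x) (D x) x.1 / x.1%:R ^+ 2))).
  move=> [k e] /= k0 e0; rewrite /sumV /U /S /D /=.
  by field; rewrite !gt_eqF.
rewrite -[X in _ --> X](addr0 (1 : F)).
apply: cvgD cvg_coefU _; rewrite -[X in _ --> X](mul0r (2^-1 : F)).
apply: cvgM cvg_sumU; rewrite -[X in _ --> X](mulr0 (a + b)).
by apply: cvgM largek_ke; apply: cvgD; [exact: cvg_largek_comp hs|exact: cvg_largek_comp hd].
Qed.

(** The upper bound is Bernoulli's inequality, the lower one its second order counterpart; their
    ratio tends to 1 once (1 - d) k tends to 0. *)
Lemma pow1_bounds (d1 : F) k : 0 <= d1 <= 1 ->
  (1 - d1) * k%:R * (1 - (1 - d1) * k%:R) <= 1 - d1 ^+ k <= (1 - d1) * k%:R.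
Proof.
move=> /andP[d0 d11]; elim: k => [|k]; first by rewrite expr0; apply/andP; split; lra.
rewrite exprS -natr1; set K : F := k%:R => /andP[h1 h2].
have K0 : 0 <= K by exact: ler0n.
set Y := d1 ^+ k in h1 h2 *.
pose x := 1 - d1; have x0 : 0 <= x by rewrite subr_ge0.
have -> : d1 = 1 - x by rewrite /x; ring.
rewrite -/x in h1 h2.
have -> : 1 - (1 - x) = x by ring.
have hx : 1 - x = d1 by rewrite /x; ring.
have e1 : (1 - x) * (1 - Y) <= (1 - x) * (x * K) by rewrite ler_wpM2l ?hx.
have e2 : (1 - x) * (x * K * (1 - x * K)) <= (1 - x) * (1 - Y) by rewrite ler_wpM2l ?hx.
have e3 : 0 <= x * (x * K) by rewrite !mulr_ge0.
have e4 : 0 <= x * (x * x * K ^+ 2) by rewrite !mulr_ge0 // sqr_ge0.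
have e5 : 0 <= x * x by rewrite mulr_ge0.
by apply/andP; split; nra.
Qed.

Lemma cvg_powd : (1 - D x ^+ x.1) / (x.1%:R * x.2) @[x --> largek] --> b.
Proof.
apply: (@squeeze_cvgr _ _ _ _
  (fun x => ((1 - d x.2) / x.2) * (1 - (1 - D x) * x.1%:R)) (fun x => (1 - d x.2) / x.2)).
- near=> x; have [k0 e0 s0 /andP[d0 d1] sk] : [/\ 0 < x.1%:R :> F, 0 < x.2, 0 < S x,
    0 < D x < 1 & S x * x.1%:R ^+ 2 <= 1] by near: x; exact: largek_sd.
  have d01 : 0 <= D x <= 1 by rewrite !ltW.
  have /andP[h1 h2] := pow1_bounds x.1 d01.
  have ke : 0 < x.1%:R * x.2 by rewrite mulr_gt0.
  rewrite ler_pdivlMr // ler_pdivrMr //; apply/andP; split.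
    by apply: le_trans h1; rewrite le_eqVlt; apply/orP; left; apply/eqP; rewrite /D; field; rewrite gt_eqF.
  apply: (le_trans h2).
  by rewrite le_eqVlt; apply/orP; left; apply/eqP; rewrite /D; field; rewrite gt_eqF.
- rewrite [X in _ --> X](_ : b = b * (1 - 0)); last by ring.
  apply: cvgM; first exact: cvg_largek_comp hd.
  by apply: cvgB largek_dk; exact: cvg_cst.
- exact: cvg_largek_comp hd.
Unshelve. all: by end_near. Qed.

End PowerLimits.
End LargeK.

(** * Differentiability at e = 0 of matrices and of words *)

Section Derivability.
Variable F : realType.
Implicit Types g : F -> F.

Lemma derivable_quot g : derivable g 0 1 ->
  exists l : F, (g e - g 0) / e @[e --> 0^'] --> l.
Proof.
move=> /cvg_ex[l hl]; exists l; move: hl; apply: cvg_trans.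
apply: near_eq_cvg; near=> e.
by rewrite /= addr0 /GRing.scale /= mulr1 mulrC.
Unshelve. all: by end_near. Qed.

Lemma derivable_cvg0 g : derivable g 0 1 -> g e @[e --> 0^'] --> g 0.
Proof.
move=> /derivable1_diffP hg; have := differentiable_continuous hg.
by apply: cvg_trans; apply: cvg_app; apply: cvg_within.
Qed.

Lemma cvg_largek0 g : derivable g 0 1 -> g x.2 @[x --> @largek F] --> g 0.
Proof. by move=> hg; apply: cvg_largek_comp (derivable_cvg0 hg). Qed.

Variant mx_derivable m n (A : F -> 'M[F]_(m, n)) : Prop :=
  MxDerivable of forall i j, derivable (fun e => A e i j) 0 1.

Lemma mx_derivable_entry m n (A : F -> 'M[F]_(m, n)) i j :
  mx_derivable A -> derivable (fun e => A e i j) 0 1.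
Proof. by case. Qed.

Lemma mx_derivable_cst m n (A : 'M[F]_(m, n)) : mx_derivable (fun=> A).
Proof. by split=> i j; apply: derivable_cst. Qed.

Lemma mx_derivableD m n (A B : F -> 'M[F]_(m, n)) :
  mx_derivable A -> mx_derivable B -> mx_derivable (fun e => A e + B e).
Proof.
move=> [hA] [hB]; split=> i j; under eq_fun do rewrite mxE.
exact: derivableD (hA i j) (hB i j).
Qed.

Lemma mx_derivableB m n (A B : F -> 'M[F]_(m, n)) :
  mx_derivable A -> mx_derivable B -> mx_derivable (fun e => A e - B e).
Proof.
move=> [hA] [hB]; split=> i j; under eq_fun do rewrite !mxE.
exact: derivableB (hA i j) (hB i j).
Qed.

Lemma mx_derivableZ m n (a : F) (A : F -> 'M[F]_(m, n)) :
  mx_derivable A -> mx_derivable (fun e => a *: A e).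
Proof.
move=> hA; split=> i j; under eq_fun do rewrite !mxE.
apply: derivableM; [exact: (derivable_cst a)|exact: mx_derivable_entry].
Qed.

Lemma mx_derivableM n (A : F -> 'M[F]_2) (B : F -> 'M[F]_(2, n)) :
  mx_derivable A -> mx_derivable B -> mx_derivable (fun e => A e *m B e).
Proof.
move=> [hA] [hB]; split=> i j; under eq_fun do rewrite mulmx2E.
by apply: derivableD; apply: derivableM.
Qed.

Lemma derivable_tr2 (A : F -> 'M[F]_2) : mx_derivable A ->
  derivable (fun e => \tr (A e)) 0 1.
Proof.
move=> [hA]; under eq_fun do rewrite tr2E.
exact: derivableD.
Qed.

Lemma derivable_det2 (A : F -> 'M[F]_2) : mx_derivable A ->
  derivable (fun e => \det (A e)) 0 1.
Proof.
move=> [hA]; under eq_fun do rewrite det2E.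
by apply: derivableB; apply: derivableM (hA _ _) (hA _ _).
Qed.

Lemma mx_derivable_adj2 (A : F -> 'M[F]_2) : mx_derivable A ->
  mx_derivable (fun e => adj2 (A e)).
Proof.
move=> hA; split=> i j; rewrite /adj2; under eq_fun do rewrite !mxE.
apply: derivableB; last exact: mx_derivable_entry.
case: (i == j).
  by under eq_fun do rewrite mulr1n; exact: derivable_tr2.
by under eq_fun do rewrite mulr0n; exact: derivable_cst.
Qed.

Lemma smooth_derivable g : smooth_near0 g -> derivable g 0 1.
Proof. by move=> /nbhs_singleton /(_ 0%N). Qed.

Section Words.
Variables (tL dL tR dR : F -> F) (m : F).
Let P e := Params (tL e) (dL e) (tR e) (dR e) m.
Hypotheses (htL : derivable tL 0 1) (hdL : derivable dL 0 1)
  (htR : derivable tR 0 1) (hdR : derivable dR 0 1).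

Lemma mx_derivable_Amx J : mx_derivable (fun e => Amx (P e) J).
Proof.
split=> i j; under eq_fun do rewrite mxE.
case: (i == 0); case: (j == 0).
- by case: J; [exact: htL|exact: htR].
- exact: (derivable_cst (1 : F)).
- by case: J; apply: derivableN; [exact: hdL|exact: hdR].
- exact: (derivable_cst (0 : F)).
Qed.

Lemma mx_derivable_Mword S : mx_derivable (fun e => Mword (P e) S).
Proof.
elim/last_ind: S => [|S J IH]; first exact: (@mx_derivable_cst 2 2 1%:M).
have := mx_derivableM (mx_derivable_Amx J) IH.
by under eq_fun do rewrite -Mword_rcons.
Qed.

Lemma mx_derivable_fword S : mx_derivable (fun e => fword (P e) S 0).
Proof.
elim/last_ind: S => [|S J IH]; first exact: (@mx_derivable_cst 2 1 0).
have h := mx_derivableD (mx_derivableM (mx_derivable_Amx J) IH)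
  (@mx_derivable_cst 2 1 (m *: delta_mx 0 0)).
by under eq_fun do rewrite fword_rcons; exact: h.
Qed.

End Words.
End Derivability.

(** * Asymptotics of the cycles *)

Section CycleNumerator.
Variable F : realFieldType.
Variables (M B : 'M[F]_2) (p q : 'cV[F]_2) (b : F) (k : nat).
Let s := 1 - \tr M + \det M.
Let d := \det M.
Let N := M - 1%:M.
Let V := coefV s d k.
Let U := coefU s d k.
Let a := sumV s d k.
Let u := sumU s d k.
Let w := V + (d - s - 1) * U.
Let H := B + 1%:M - b *: N.

(** Telescoping: M - 1 times the sum of the M ^ j p over j < k is (M ^ k - 1) p. *)
Lemma mulN_sum : N *m (a *: p + u *: (N *m p)) = (V - 1) *: p + U *: (N *m p).
Proof.
rewrite mulmxDr -!scalemxAr /N sub1_sqr_mul -/N -/s.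
rewrite (_ : \tr M - 2 = d - s - 1); last by rewrite /s /d; ring.
move: (N *m p) => p1; have hV : V = 1 - s * u by rewrite mul_sumU; ring.
by apply/matrixP => i j; rewrite !mxE hV /a /sumV -/u -/U; ring.
Qed.

(** The numerator of the starting point of the cycle, arranged by size. Only u is of order k^2, up
    to smaller terms or products like U a. It occurs in the combination u (1 + V) - U a of
    [sumU_cancel], or next to one of the factors H and det B - 1, which vanish at e = 0. Here w is
    the scalar part of the adjugate of M ^ k. *)
Lemma cycle_numerator :
  (1%:M - adj2 (B *m powV M k)) *m (B *m (a *: p + u *: (N *m p)) + q)
  = - ((a + (w * a - U * (V - 1))) *: p
       + (u * (1 + V) - U * a) *: (N *m p))
    + b *: ((V - 1) *: p + U *: (N *m p))
    + a *: (H *m p) + u *: (H *m (N *m p))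
    - (\det B - 1) *: ((w * a - U * (V - 1)) *: p + (V * u - U * a) *: (N *m p))
    + q - w *: (adj2 B *m q) + U *: (N *m (adj2 B *m q)).
Proof.
have hBx (x : 'cV[F]_2) H0 N0 : B = H0 - 1%:M + b *: N0 ->
    B *m x = H0 *m x - x + b *: (N0 *m x).
  by move=> ->; rewrite mulmxDl mulmxBl mul1mx -scalemxAl.
rewrite adj2M mulmxBl mul1mx -mulmxA [adj2 B *m (_ + _)]mulmxDr [adj2 B *m (B *m _)]mulmxA adj2_mul.
rewrite mul_scalar_mx adj2_powV -/N -/s -/d -/V -/U -/w.
rewrite [(_ *: 1%:M - _) *m _]mulmxBl.
rewrite -!scalemxAl mul1mx [N *m (_ + _)]mulmxDr.
rewrite -[N *m (\det B *: _)]scalemxAr mulN_sum.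
have -> : B *m (a *: p + u *: (N *m p)) = a *: (H *m p) + u *: (H *m (N *m p))
    - (a *: p + u *: (N *m p)) + b *: ((V - 1) *: p + U *: (N *m p)).
  rewrite (hBx _ H N) ?mulN_sum; last first.
    by rewrite /H; apply/matrixP => i j; rewrite !mxE; ring.
  by rewrite [H *m (_ + _)]mulmxDr -[H *m (a *: _)]scalemxAr -[H *m (u *: _)]scalemxAr.
move: (N *m p) (H *m p) (H *m (N *m p)) (adj2 B *m q) => p1 p2 p3 y.
move: (N *m y) => y1.
by apply/matrixP => i j; rewrite !mxE /w /a /sumV -/u -/U; ring.
Qed.

End CycleNumerator.

(* For unperturbed parameters the S[k]-cycle starts at
   [k%:R *: cycle_slope + cycle_offset]. *)
Definition cycle_slope (F : realFieldType) (N : 'M[F]_2) (p q : 'cV[F]_2) (b : F) :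
  'cV[F]_2 := 4^-1 *: (- (2 *: p) + (1 + b) *: (N *m p) - N *m q).

Definition cycle_offset (F : realFieldType) (N : 'M[F]_2) (q : 'cV[F]_2) (b : F) :
  'cV[F]_2 := 4^-1 *: (2 *: q + b *: (N *m q)).

Section CycleLimits.
Variable F : realType.
Variables (M B : F -> 'M[F]_2) (p q : F -> 'cV[F]_2) (b a' b' : F).
Hypotheses (hM : mx_derivable M) (hB : mx_derivable B) (hp : mx_derivable p)
  (hq : mx_derivable q).
Let s e := 1 - \tr (M e) + \det (M e).
Let d e := \det (M e).
Hypotheses (a0 : 0 < a') (b0 : 0 < b').
Hypotheses (hs : s e / e @[e --> 0^'] --> a') (hd : (1 - d e) / e @[e --> 0^'] --> b').
Hypothesis hB0 : B 0 = b *: (M 0 - 1%:M) - 1%:M.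
Hypotheses (trM0 : \tr (M 0) = 2) (detM0 : \det (M 0) = 1).

Local Notation lk := (@largek F).
Local Notation N e := (M e - 1%:M).
Local Notation k_ x := (x.1%:R : F).

Let S (x : nat * F) := s x.2.
Let D (x : nat * F) := d x.2.
Let V (x : nat * F) := coefV (S x) (D x) x.1.
Let U (x : nat * F) := coefU (S x) (D x) x.1.
Let u (x : nat * F) := sumU (S x) (D x) x.1.
Let a (x : nat * F) := sumV (S x) (D x) x.1.
Let w (x : nat * F) := V x + (D x - S x - 1) * U x.

Let cV : V x @[x --> lk] --> (1 : F). Proof. exact: (cvg_coefV a0 b0 hs hd). Qed.
Let cU : U x / k_ x @[x --> lk] --> (1 : F). Proof. exact: (cvg_coefU a0 b0 hs hd). Qed.
Let cu : u x / k_ x ^+ 2 @[x --> lk] --> (2^-1 : F). Proof. exact: (cvg_sumU a0 b0 hs hd). Qed.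
Let ca : a x / k_ x @[x --> lk] --> (1 : F). Proof. exact: (cvg_sumV a0 b0 hs hd). Qed.
Let cs : s x.2 / x.2 @[x --> lk] --> a'. Proof. exact: cvg_largek_comp hs. Qed.
Let cd : (1 - d x.2) / x.2 @[x --> lk] --> b'. Proof. exact: cvg_largek_comp hd. Qed.

Lemma cvg_trdefect : (D x - S x - 1) / x.2 @[x --> lk] --> - (a' + b').
Proof.
apply: (@cvg_largek_eq _ _ (fun x => - (s x.2 / x.2 + (1 - d x.2) / x.2))).
  by move=> [k e] /= k0 e0; rewrite /D /S /=; field; rewrite gt_eqF.
by apply: cvgN; apply: cvgD.
Qed.

Let cw : w x @[x --> lk] --> (1 : F).
Proof.
apply: (@cvg_largek_eq _ _ (fun x => V x + (D x - S x - 1) / x.2 * ((k_ x * x.2) * (U x / k_ x)))).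
  by move=> [k e] /= k0 e0; rewrite /w /=; field; rewrite !gt_eqF.
rewrite [X in _ --> X](_ : 1 = 1 + - (a' + b') * (0 * 1)); last by ring.
apply: cvgD => //; apply: cvgM; first exact: cvg_trdefect.
by apply: cvgM => //; exact: largek_ke.
Qed.

Let c3 x := w x * a x - U x * (V x - 1).
Let c2 x := u x * (1 + V x) - U x * a x.
Let c4 x := V x * u x - U x * a x.

Let cc3 : c3 x / k_ x @[x --> lk] --> (1 : F).
Proof.
apply: (@cvg_largek_eq _ _ (fun x => w x * (a x / k_ x) - (U x / k_ x) * (V x - 1))).
  by move=> [k e] /= k0 e0; rewrite /c3 /=; field; rewrite gt_eqF.
rewrite [X in _ --> X](_ : 1 = 1 * 1 - 1 * (1 - 1)); last by ring.
apply: cvgB; first exact: cvgM cw ca.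
by apply: cvgM cU _; apply: cvgB cV _; exact: cvg_cst.
Qed.

Let cc1 : (a x + c3 x) / k_ x @[x --> lk] --> (2 : F).
Proof.
apply: (@cvg_largek_eq _ _ (fun x => a x / k_ x + c3 x / k_ x)).
  by move=> x _ _; rewrite mulrDl.
exact: cvgD ca cc3.
Qed.

(** By [sumU_cancel], s c2 = (1 - d^k) + (d - s - 1) U, which is close to b' k e - (a' + b') k e = -
    a' k e, while s is close to a' e. *)
Let cc2 : c2 x / k_ x @[x --> lk] --> (-1 : F).
Proof.
have h : ((1 - D x ^+ x.1) / (k_ x * x.2) + ((D x - S x - 1) / x.2) * (U x / k_ x))
    / (s x.2 / x.2) @[x --> lk] --> (-1 : F).
  rewrite [X in _ --> X](_ : -1 = (b' + - (a' + b') * 1) / a'); last first.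
    by field; rewrite gt_eqF.
  apply: cvgM; last by apply: cvgV => //; rewrite gt_eqF.
  apply: cvgD; first exact: (cvg_powd a0 b0 hs hd).
  by apply: cvgM => //; exact: cvg_trdefect.
apply: cvg_trans h; apply: near_eq_cvg.
near=> x; have [k0 e0 s0 _ _] : [/\ 0 < x.1%:R :> F, 0 < x.2, 0 < S x,
    0 < D x < 1 & S x * x.1%:R ^+ 2 <= 1] by near: x; exact: (largek_sd a0 b0 hs hd).
have := sumU_cancel (S x) (D x) x.1; rewrite -/(u x) -/(V x) -/(U x) -/(a x) -/(c2 x).
move=> hc; have -> : c2 x = (S x * c2 x) / S x by field; rewrite gt_eqF.
rewrite hc -/(S x); field; rewrite !gt_eqF //.
Unshelve. all: by end_near. Qed.

Let cc4 (g : F -> F) : derivable g 0 1 -> g 0 = 0 ->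
  g x.2 * c4 x / k_ x @[x --> lk] --> (0 : F).
Proof.
move=> /derivable_quot [l hl] g0.
apply: (@cvg_largek_eq _ _ (fun x => ((g x.2 - g 0) / x.2) *
   ((k_ x * x.2) * (V x * (u x / k_ x ^+ 2) - (U x / k_ x) * (a x / k_ x))))).
  by move=> [k e] /= k0 e0; rewrite /c4 g0 /=; field; rewrite !gt_eqF.
rewrite [X in _ --> X](_ : 0 = l * (0 * (1 * 2^-1 - 1 * 1))); last by ring.
apply: cvgM; first exact: cvg_largek_comp hl.
apply: cvgM; first exact: largek_ke.
by apply: cvgB; [exact: cvgM cV cu|exact: cvgM cU ca].
Qed.

Let cua (g : F -> F) : derivable g 0 1 -> g 0 = 0 ->
  u x * g x.2 / k_ x @[x --> lk] --> (0 : F).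
Proof.
move=> /derivable_quot [l hl] g0.
apply: (@cvg_largek_eq _ _ (fun x => ((g x.2 - g 0) / x.2) *
   ((k_ x * x.2) * (u x / k_ x ^+ 2)))).
  by move=> [k e] /= k0 e0; rewrite g0 /=; field; rewrite !gt_eqF.
rewrite [X in _ --> X](_ : 0 = l * (0 * 2^-1)); last by ring.
apply: cvgM; first exact: cvg_largek_comp hl.
by apply: cvgM cu; exact: largek_ke.
Qed.

Let A x := B x.2 *m powV (M x.2) x.1.

Let sqrN0 : N 0 *m N 0 = 0.
Proof. by rewrite sub1_sqr trM0 detM0 subrr scale0r (_ : 1 - 2 + 1 = 0) ?scale0r ?subrr //; ring. Qed.

Let trN0 : \tr (N 0) = 0.
Proof. by rewrite raddfB /= mxtrace1 trM0 subrr. Qed.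

Let detN0 : \det (N 0) = 0.
Proof.
have -> : \det (N 0) = \det (M 0) - \tr (M 0) + 1.
  by rewrite !det2E tr2E !mxE /=; ring.
by rewrite detM0 trM0; ring.
Qed.

Lemma det_B0 : \det (B 0) = 1.
Proof.
have -> : \det (B 0) = b ^+ 2 * \det (N 0) - b * \tr (N 0) + 1.
  by rewrite hB0 !det2E tr2E !mxE /=; ring.
by rewrite detN0 trN0; ring.
Qed.

Lemma tr_B0 : \tr (B 0) = - 2.
Proof. by rewrite hB0 raddfB /= mxtrace1 mxtraceZ trN0 mulr0 sub0r. Qed.

Let hN : mx_derivable (fun e => N e).
Proof. by apply: mx_derivableB => //; exact: (@mx_derivable_cst F 2 2 1%:M). Qed.

Let trBN e := \tr (B e *m N e).

Let trBN0 : trBN 0 = 0.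
Proof.
by rewrite /trBN hB0 mulmxBl -scalemxAl sqrN0 scaler0 mul1mx sub0r raddfN /= trN0 oppr0.
Qed.

Let ck2 : (k_ x)^-1 ^+ 2 @[x --> lk] --> (0 : F).
Proof.
rewrite [X in _ --> X](_ : 0 = 0 * 0); last by ring.
by under eq_fun do rewrite expr2; apply: cvgM; exact: largek_kV.
Qed.

Let cdk : D x ^+ x.1 @[x --> lk] --> (1 : F).
Proof.
apply: (@cvg_largek_eq _ _ (fun x => 1 - (1 - D x ^+ x.1) / (k_ x * x.2) * (k_ x * x.2))).
  by move=> [k e] /= k0 e0; field; rewrite !gt_eqF.
rewrite [X in _ --> X](_ : 1 = 1 - b' * 0); last by ring.
apply: cvgB; first exact: cvg_cst.
by apply: cvgM; [exact: (cvg_powd a0 b0 hs hd)|exact: largek_ke].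
Qed.

Let trA x : \tr (A x) = V x * \tr (B x.2) + U x * trBN x.2.
Proof.
rewrite /A /powV mulmxDr -!scalemxAr mulmx1 raddfD /= !mxtraceZ.
by rewrite /V /U /S /D.
Qed.

Let detA x : \det (A x) = \det (B x.2) * D x ^+ x.1.
Proof. by rewrite /A det_mulmx det_powV. Qed.

(** Substituting V = 1 - s u in V tr B isolates the dominant term 2 s u, where s is close to a' e
    and u to k^2 / 2. The variations of tr B, tr (B N), det B and d^k are only of order e or k e. *)
Lemma cvg_jury1 : (1 + \tr (A x) + \det (A x)) / (k_ x ^+ 2 * x.2) @[x --> lk] --> a'.
Proof.
have [l1 hl1] := derivable_quot (derivable_tr2 hB).
have [l2 hl2] := derivable_quot (derivable_det2 hB).
have [l3 hl3] := derivable_quot (derivable_tr2 (mx_derivableM hB hN)).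
apply: (@cvg_largek_eq _ _ (fun x => 2 * ((s x.2 / x.2) * (u x / k_ x ^+ 2))
   + (\tr (B x.2) - \tr (B 0)) / x.2 * (V x * (k_ x)^-1 ^+ 2)
   + (trBN x.2 - trBN 0) / x.2 * (U x / k_ x * (k_ x)^-1)
   - (1 - D x ^+ x.1) / (k_ x * x.2) * (k_ x)^-1
   + (\det (B x.2) - \det (B 0)) / x.2 * (D x ^+ x.1 * (k_ x)^-1 ^+ 2))).
  move=> x k0 e0; rewrite trA detA tr_B0 trBN0 det_B0.
  have -> : V x = 1 - S x * u x by rewrite mul_sumU; rewrite /V; ring.
  by rewrite /S; field; rewrite !gt_eqF.
rewrite [X in _ --> X](_ : a' = 2 * (a' * 2^-1) + l1 * (1 * 0) + l3 * (1 * 0)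
  - b' * 0 + l2 * (1 * 0)); last by field.
apply: cvgD; last first.
  by apply: cvgM; [exact: cvg_largek_comp hl2|exact: cvgM cdk ck2].
apply: cvgB; last first.
  by apply: cvgM; [exact: (cvg_powd a0 b0 hs hd)|exact: largek_kV].
apply: cvgD; last first.
  apply: cvgM; first exact: cvg_largek_comp hl3.
  by apply: cvgM; [exact: cU|exact: largek_kV].
apply: cvgD; last first.
  by apply: cvgM; [exact: cvg_largek_comp hl1|exact: cvgM cV ck2].
by apply: cvgM; [exact: cvg_cst|exact: cvgM cs cu].
Qed.

Lemma cvg_jury2 : (1 - \det (A x)) / (k_ x * x.2) @[x --> lk] --> b'.
Proof.
have [l2 hl2] := derivable_quot (derivable_det2 hB).
apply: (@cvg_largek_eq _ _ (fun x => (1 - D x ^+ x.1) / (k_ x * x.2)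
   - (\det (B x.2) - \det (B 0)) / x.2 * (D x ^+ x.1 * (k_ x)^-1))).
  by move=> x k0 e0; rewrite detA det_B0; field; rewrite !gt_eqF.
rewrite [X in _ --> X](_ : b' = b' - l2 * (1 * 0)); last by ring.
apply: cvgB; first exact: (cvg_powd a0 b0 hs hd).
apply: cvgM; first exact: cvg_largek_comp hl2.
by apply: cvgM; [exact: cdk|exact: largek_kV].
Qed.

Lemma cvg_jury3 : 1 - \tr (A x) + \det (A x) @[x --> lk] --> (4 : F).
Proof.
have [l3 hl3] := derivable_quot (derivable_tr2 (mx_derivableM hB hN)).
apply: (@cvg_largek_eq _ _ (fun x => 1 - (V x * \tr (B x.2) +
    U x / k_ x * ((k_ x * x.2) * ((trBN x.2 - trBN 0) / x.2))) +
    \det (B x.2) * D x ^+ x.1)).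
  by move=> x k0 e0; rewrite trA detA trBN0; field; rewrite !gt_eqF.
rewrite [X in _ --> X](_ : 4 = 1 - (1 * \tr (B 0) + 1 * (0 * l3)) + \det (B 0) * 1);
  last by rewrite tr_B0 det_B0; ring.
apply: cvgD; last by apply: cvgM cdk; exact: (cvg_largek0 (derivable_det2 hB)).
apply: cvgB; first exact: cvg_cst.
apply: cvgD; first by apply: cvgM; [exact: cV|exact: (cvg_largek0 (derivable_tr2 hB))].
apply: cvgM; first exact: cU.
by apply: cvgM; [exact: largek_ke|exact: cvg_largek_comp hl3].
Qed.

Definition cycle_base x : 'cV[F]_2 := (1 - \tr (A x) + \det (A x))^-1 *:
  ((1%:M - adj2 (A x)) *m
     (B x.2 *m (a x *: p x.2 + u x *: (N x.2 *m p x.2)) + q x.2)).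

Let slope := cycle_slope (N 0) (p 0) (q 0) b.

Let H e := B e + 1%:M - b *: N e.
Let hH : mx_derivable H.
Proof.
apply: mx_derivableB; last exact: mx_derivableZ.
by apply: mx_derivableD => //; exact: (@mx_derivable_cst F 2 2 1%:M).
Qed.
Let H0 : H 0 = 0.
Proof. by rewrite /H hB0 subrK subrr. Qed.

Lemma cvg_cycle_base i : cycle_base x i 0 / k_ x @[x --> lk] --> slope i 0.
Proof.
have dNp := mx_derivableM hN hp.
have dHp : derivable (fun e => (H e *m p e) i 0) 0 1 :=
  mx_derivable_entry (mx_derivableM hH hp).
have dHNp : derivable (fun e => (H e *m (N e *m p e)) i 0) 0 1 :=
  mx_derivable_entry (mx_derivableM hH dNp).
have dy := mx_derivableM (mx_derivable_adj2 hB) hq.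
have dNy := mx_derivableM hN dy.
have Hp0 : (H 0 *m p 0) i 0 = 0 by rewrite H0 mul0mx mxE.
have HNp0 : (H 0 *m (N 0 *m p 0)) i 0 = 0 by rewrite H0 mul0mx mxE.
have dB1 : derivable (fun e => \det (B e) - 1) 0 1.
  by apply: derivableB; [exact: derivable_det2|exact: derivable_cst].
have B01 : \det (B 0) - 1 = 0 by rewrite det_B0 subrr.
pose c1 x := a x + c3 x.
pose y e := adj2 (B e) *m q e.
apply: (@cvg_largek_eq _ _ (fun x => (1 - \tr (A x) + \det (A x))^-1 * (
  - (c1 x / k_ x * p x.2 i 0 + c2 x / k_ x * (N x.2 *m p x.2) i 0)
  + b * ((V x - 1) * (k_ x)^-1 * p x.2 i 0 + U x / k_ x * (N x.2 *m p x.2) i 0)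
  + a x / k_ x * (H x.2 *m p x.2) i 0
  + u x * (H x.2 *m (N x.2 *m p x.2)) i 0 / k_ x
  - ((\det (B x.2) - 1) * (c3 x / k_ x) * p x.2 i 0
     + (\det (B x.2) - 1) * c4 x / k_ x * (N x.2 *m p x.2) i 0)
  + (k_ x)^-1 * q x.2 i 0 - w x * (k_ x)^-1 * y x.2 i 0
  + U x / k_ x * (N x.2 *m y x.2) i 0))).
  move=> x k0 e0; rewrite /cycle_base mxE (cycle_numerator _ _ _ _ b).
  rewrite -/(d x.2) -/(s x.2) -/(S x) -/(D x) -/(V x) -/(U x) -/(a x) -/(u x) -/(w x).
  rewrite -/(H x.2) -/(c3 x) -/(c2 x) -/(c4 x) -/(c1 x) -/(y x.2).
  move: (N x.2 *m p x.2) (H x.2 *m p x.2) => p1 p2.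
  move: (H x.2 *m p1) (N x.2 *m y x.2) (y x.2) (p x.2) (q x.2) => p3 y1 y0 p0 q0.
  move: (_^-1) (\det (B _) - 1) (c1 x) (c2 x) (c3 x) (c4 x) (V x) (U x) (a x)
    (u x) (w x) => i1 dB e1 e2 e3 e4 V0 U0 a1 u0 w0.
  by rewrite !mxE; field; rewrite gt_eqF.
rewrite [X in _ --> X](_ : slope i 0 = 4^-1 * (
  - (2 * p 0 i 0 + -1 * (N 0 *m p 0) i 0)
  + b * ((1 - 1) * 0 * p 0 i 0 + 1 * (N 0 *m p 0) i 0)
  + 1 * (H 0 *m p 0) i 0 + 0
  - ((\det (B 0) - 1) * 1 * p 0 i 0 + 0 * (N 0 *m p 0) i 0)
  + 0 * q 0 i 0 - 1 * 0 * y 0 i 0 + 1 * (N 0 *m y 0) i 0)); last first.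
  (* At e = 0 the adjugate of B is - 1 - b N, and N^2 = 0. *)
  have -> : N 0 *m y 0 = - (N 0 *m q 0).
    rewrite /y mulmxA /adj2 tr_B0 hB0 mulmxBr mulmxBr -scalemxAr sqrN0 scaler0.
    rewrite mulmx1 sub0r opprK scalar_mxC mul_scalar_mx -mulNmx; congr (_ *m _).
    by apply/matrixP => i' j'; rewrite !mxE; ring.
  rewrite Hp0 det_B0 /slope /cycle_slope; move: (N 0 *m p 0) (N 0 *m q 0) => p1 q1.
  by rewrite !mxE; ring.
have cp : p x.2 i 0 @[x --> lk] --> p 0 i 0 := cvg_largek0 (mx_derivable_entry hp).
have cNp : (N x.2 *m p x.2) i 0 @[x --> lk] --> (N 0 *m p 0) i 0 :=
  cvg_largek0 (mx_derivable_entry dNp).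
apply: cvgM; first by apply: cvgV; [rewrite pnatr_eq0|exact: cvg_jury3].
apply: cvgD; last first.
  by apply: cvgM cU _; exact: (cvg_largek0 (mx_derivable_entry dNy)).
apply: cvgB; last first.
  apply: cvgM; first by apply: cvgM cw _; exact: largek_kV.
  exact: (cvg_largek0 (mx_derivable_entry dy)).
apply: cvgD; last first.
  by apply: cvgM; [exact: largek_kV|exact: (cvg_largek0 (mx_derivable_entry hq))].
apply: cvgB; last first.
  apply: cvgD.
    by apply: cvgM cp; apply: cvgM cc3; exact: (cvg_largek0 dB1).
  by apply: cvgM cNp; exact: (cc4 dB1 B01).
apply: cvgD; last exact: (cua dHNp HNp0).
apply: cvgD; last by apply: cvgM ca _; exact: (cvg_largek0 dHp).
apply: cvgD.
  by apply: cvgN; apply: cvgD; [exact: cvgM cc1 cp|exact: cvgM cc2 cNp].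
apply: cvgM; first exact: cvg_cst.
apply: cvgD; last exact: cvgM cU cNp.
apply: cvgM cp; apply: cvgM; last exact: largek_kV.
by apply: cvgB cV _; exact: cvg_cst.
Qed.

End CycleLimits.

(** * Unperturbed cycles *)

Section ReflectionStructure.
Variable F : realFieldType.

Let reflection_scalars (n n2 n3 a b c d : F) :
  [|| n2 != 0 | n3 != 0] -> n2 * n3 = - n ^+ 2 ->
  a * d - b * c = 1 -> (a - d) * n + b * n3 + c * n2 = 0 ->
  -2 <= a + d <= 2 -> a + d != 2 ->
  exists e, [/\ a = e * n - 1, b = e * n2, c = e * n3 & d = - (e * n) - 1].
Proof.
move=> N0 dN dB hBN hB hB2.
have trm : (a - d) ^+ 2 + 4 * b * c = 0 -> a + d = -2.
  move=> h; have h4 : (a + d) ^+ 2 = 4.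
    have -> : (a + d) ^+ 2 = (a - d) ^+ 2 + 4 * b * c + 4 * (a * d - b * c) by ring.
    by rewrite h dB; ring.
  have : (a + d - 2) * (a + d + 2) = 0.
    by rewrite -[RHS](subrr 4) -[X in _ = X - _]h4; ring.
  move/eqP; rewrite mulf_eq0 subr_eq0 (negbTE hB2) /= => /eqP h5.
  by rewrite -[LHS]subr0 -h5; ring.
have disc : (a - d) ^+ 2 + 4 * b * c <= 0.
  have -> : (a - d) ^+ 2 + 4 * b * c = (a + d) ^+ 2 - 4 * (a * d - b * c) by ring.
  rewrite dB; move/andP: hB => [hB1 hB3]; nra.
have [n20|n20] := eqVneq n2 0.
  have n0 : n = 0.
    by apply/eqP; rewrite -[_ == _]sqrf_eq0 -oppr_eq0 -dN n20 mul0r.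
  have n30 : n3 != 0 by rewrite n20 eqxx in N0.
  have b0 : b = 0.
    move: hBN; rewrite n0 n20 !mulr0 add0r addr0 => /eqP.
    by rewrite mulf_eq0 (negbTE n30) orbF => /eqP.
  have ad : a - d = 0.
    apply/eqP; rewrite -sqrf_eq0 eq_le sqr_ge0 andbT.
    by rewrite b0 mulr0 mul0r addr0 in disc.
  have ad2 : a + d = -2 by apply: trm; rewrite ad b0; ring.
  exists (c / n3); rewrite n20 n0 b0; split; [lra|ring|by field|lra].
have n3E : n3 = - n ^+ 2 / n2 by rewrite -dN; field.
have cE : c = - ((a - d) * n + b * n3) / n2.
  by apply: (mulIf n20); rewrite divfK // -[LHS]subr0 -hBN; ring.
(* The trace condition makes the discriminant of B, times n2^2, a square. So it is nonnegative,
   while the bound on the trace makes it nonpositive. *)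
have sq : ((a - d) * n2 - 2 * b * n) ^+ 2 = ((a - d) ^+ 2 + 4 * b * c) * n2 ^+ 2.
  by rewrite cE n3E; field.
have sq0 : (a - d) * n2 - 2 * b * n = 0.
  apply/eqP; rewrite -sqrf_eq0 eq_le sqr_ge0 andbT sq.
  by rewrite mulr_le0_ge0 // sqr_ge0.
have disc0 : (a - d) ^+ 2 + 4 * b * c = 0.
  by apply: (mulIf (expf_neq0 2 n20)); rewrite -sq sq0; ring.
have ad2 := trm disc0.
have ad : a - d = 2 * b * n / n2.
  by apply: (mulIf n20); rewrite divfK // -[LHS]subr0 -sq0; ring.
have e1 : b / n2 * n = (a - d) / 2 by rewrite ad; field.
exists (b / n2); rewrite e1; split; [lra|by rewrite divfK| |lra].
by rewrite cE ad n3E; field.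
Qed.

(** N is nilpotent of rank one, and tr (B N) = 0 means that B preserves the line ker N. Hence B has
    real eigenvalues, with product 1; the conditions on the trace leave only the double eigenvalue
    -1. Then B + 1 is nilpotent and kills ker N, so it is a multiple of N. *)
Lemma reflection_structure (N B : 'M[F]_2) : N != 0 -> \tr N = 0 -> \det N = 0 ->
  \det B = 1 -> \tr (B *m N) = 0 -> -2 <= \tr B <= 2 -> \tr B != 2 ->
  exists b, B = b *: N - 1%:M.
Proof.
rewrite !tr2E !det2E !mulmx2E => N0 hN dN dB hBN hB hB2.
have n1 : N 1 1 = - N 0 0 by rewrite -[LHS]subr0 -hN; ring.
rewrite n1 in dN hBN.
have dN' : N 0 1 * N 1 0 = - N 0 0 ^+ 2 by rewrite -[LHS]addr0 -dN; ring.
have hBN' : (B 0 0 - B 1 1) * N 0 0 + B 0 1 * N 1 0 + B 1 0 * N 0 1 = 0.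
  by rewrite -hBN; ring.
have Nnz : [|| N 0 1 != 0 | N 1 0 != 0].
  rewrite -negb_and; apply: contra N0 => /andP[/eqP h1 /eqP h2].
  have h3 : N 0 0 = 0 by apply/eqP; rewrite -sqrf_eq0 -oppr_eq0 -dN' h1 mul0r.
  by apply/eqP/eq_mx2; rewrite !mxE // n1 h3 oppr0.
have [e [h1 h2 h3 h4]] := reflection_scalars Nnz dN' dB hBN' hB hB2.
exists e; apply: eq_mx2; rewrite !mxE /=.
- by rewrite h1.
- by rewrite h2 subr0.
- by rewrite h3 subr0.
- by rewrite h4 n1 mulrN.
Qed.

End ReflectionStructure.

Section Coef00.
Variable F : realFieldType.
Lemma sumU00 k : sumU 0 1 k = k%:R * (k%:R - 1) / 2 :> F.
Proof.
elim: k => [|k IH]; first by rewrite sumU0 !mul0r.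
by rewrite sumUS IH coef00 -natr1; field.
Qed.

Lemma sumV00 k : sumV 0 1 k = k%:R :> F.
Proof. by rewrite /sumV coef00 (_ : 0 + 1 - 1 = 0 :> F) ?mul0r ?addr0 //; ring. Qed.
End Coef00.

(* Bounds the effect of a non-negative acceleration at the middle of the orbit. *)
Lemma midpoint_le0 (F : realFieldType) (b K I : F) : 1 <= I -> `|b| <= I - 1 ->
  K = I + I \/ K = I + I + 1 -> b * K / 2 - I * (K - I) <= 0.
Proof.
move=> I1 bI; have {bI} : b <= I - 1 by apply: le_trans bI; exact: ler_norm.
by move=> bI [] ->; nra.
Qed.

Section LargeCycles.
Variables (F : realType) (pr : params F) (X Y : word) (b : F).
Local Notation M := (Mword pr X).
Local Notation p := (fword pr X 0).
Local Notation q := (fword pr Y 0).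

Definition cycle_start k : 'cV[F]_2 :=
  k%:R *: cycle_slope (M - 1%:M) p q b + cycle_offset (M - 1%:M) q b.

(* [C <= sgl F J * x] with [0 < C] says that x has the sign prescribed by the
   letter J and that x is at distance at least C from the switching manifold. *)
Definition large_cycles : Prop := forall (C : F) (K : nat), exists2 k, (K <= k)%N &
  (forall j r, (j < k)%N -> (r < size X)%N ->
     C <= sgl F (nth L X r)
            * xword pr (take r X) (iter j (fun z => M *m z + p) (cycle_start k))) /\
  (forall r, (r < size Y)%N ->
     C <= sgl F (nth L Y r)
            * xword pr (take r Y) (iter k (fun z => M *m z + p) (cycle_start k))).

End LargeCycles.

Section Unperturbed.
Variable F : realType.
Variables (pr : params F) (X Y : word).
Let M := Mword pr X.
Let B := Mword pr Y.
Let p := fword pr X 0.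
Let q := fword pr Y 0.
Let N := M - 1%:M.
Let g (z : 'cV[F]_2) := M *m z + p.
Variable b : F.
Hypotheses (trM : \tr M = 2) (detM : \det M = 1) (hB : B = b *: N - 1%:M).

Let s0 : 1 - \tr M + \det M = 0. Proof. by rewrite trM detM; ring. Qed.

Let sqrN (z : 'cV[F]_2) : N *m (N *m z) = 0.
Proof. by rewrite sub1_sqr_mul s0 trM subrr !scale0r subrr. Qed.

Lemma iter_unperturbed j z : iter j g z = z + j%:R *: (N *m z) + j%:R *: p
  + (j%:R * (j%:R - 1) / 2) *: (N *m p).
Proof. by rewrite /g iter_affine s0 detM !coef00 sumU00 sumV00 scale1r. Qed.

Let zeta := cycle_slope N p q b.
Let zeta0 := cycle_offset N q b.

Let BxE (x : 'cV[F]_2) : B *m x = b *: (N *m x) - x.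
Proof. by rewrite hB mulmxBl mul1mx -scalemxAl. Qed.

Let zk k := cycle_start pr X Y b k.

Let N_iter j z : N *m iter j g z = N *m z + j%:R *: (N *m p).
Proof.
rewrite iter_unperturbed !mulmxDr -!scalemxAr !sqrN !scaler0 !addr0; congr (_ + _).
Qed.

Let N_zeta : N *m zeta = (- 2^-1) *: (N *m p).
Proof.
rewrite /zeta /cycle_slope -scalemxAr !mulmxDr !mulmxN -!scalemxAr !sqrN.
by apply/matrixP => i j; rewrite !mxE; field.
Qed.

Let N_zk k : N *m zk k = (- (k%:R / 2)) *: (N *m p) + 2^-1 *: (N *m q).
Proof.
rewrite /zk /cycle_start -/M -/N -/p -/q -/zeta -/zeta0 mulmxDr -scalemxAr N_zeta /zeta0 /cycle_offset -scalemxAr mulmxDr -!scalemxAr sqrN.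
by apply/matrixP => i j; rewrite !mxE; field.
Qed.

Lemma cycle_unperturbed k : is_cycle pr (powcat X Y k) (zk k).
Proof.
apply/is_cycle_powcat; rewrite -/M -/p -/B -/q -/g BxE N_iter iter_unperturbed N_zk.
rewrite /zk /cycle_start -/M -/N -/p -/q /cycle_slope /cycle_offset; move: (N *m p) (N *m q) => p1 q1.
by apply/matrixP => i j; rewrite !mxE; field.
Qed.

Lemma powcat_det_tr k : \tr (Mword pr (powcat X Y k)) = -2 /\
  \det (Mword pr (powcat X Y k)) = 1.
Proof.
have trN : \tr N = 0 by rewrite raddfB /= mxtrace1 trM subrr.
have detN : \det N = 0.
  have -> : \det N = \det M - \tr M + 1 by rewrite !det2E tr2E !mxE /=; ring.
  by rewrite detM trM; ring.
have sqN : N *m N = 0 by rewrite sub1_sqr s0 trM subrr !scale0r subrr.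
rewrite Mword_powcat -/B -/M; split; last first.
  rewrite det_mulmx det_powV detM expr1n mulr1.
  have -> : \det B = b ^+ 2 * \det N - b * \tr N + 1.
    by rewrite hB !det2E tr2E !mxE /=; ring.
  by rewrite detN trN; ring.
rewrite /powV s0 detM !coef00 scale1r mulmxDr mulmx1 -/N -scalemxAr hB.
rewrite mulmxBl -scalemxAl sqN scaler0 sub0r mul1mx.
rewrite [\tr (_ + _ *: _)]mxtraceD [\tr (_ *: N - _)]mxtraceD !mxtraceZ.
by rewrite [\tr (- N)]raddfN [\tr (- 1%:M)]raddfN /= mxtrace1 trN; ring.
Qed.

Lemma unique_cycle_unperturbed k : unique_cycle pr (powcat X Y k) (zk k).
Proof.
split; first exact: cycle_unperturbed.
move=> z hz; apply: (is_cycle_uniq _ hz (cycle_unperturbed k)).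
by have [-> ->] := powcat_det_tr k; rewrite (_ : 1 - -2 + 1 = 4) ?pnatr_eq0 //; ring.
Qed.

Hypothesis hlarge : large_cycles pr X Y b.

Let xwordE W z : xword pr W z = (Mword pr W *m z) 0 0 + xword pr W 0.
Proof. by rewrite /xword fword_affine mxE. Qed.

Lemma slope_pos W (J : letter) (Z : nat -> 'cV[F]_2) (z1 z0 : 'cV[F]_2) :
  (forall k, Z k = k%:R *: z1 + z0) ->
  (forall C, exists k, C <= sgl F J * xword pr W (Z k)) ->
  0 < sgl F J * (Mword pr W *m z1) 0 0.
Proof.
move=> hZ hk; set c := sgl F J * ((Mword pr W *m z0) 0 0 + xword pr W 0).
(* The signed x is affine in k with constant term c, so this bound forces its k-dependent part to be
   positive. *)
have [k] := hk (1 + `|c|).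
have -> : sgl F J * xword pr W (Z k) = k%:R * (sgl F J * (Mword pr W *m z1) 0 0) + c.
  by rewrite xwordE hZ mulmxDr -scalemxAr 2!mxE /c; ring.
move=> h; have : 0 < k%:R * (sgl F J * (Mword pr W *m z1) 0 0).
  by move: h (ler_norm c); lra.
move=> h'; have k0 : k != 0%N by apply: contraTneq h' => ->; rewrite mul0r ltxx.
by move: h'; rewrite pmulr_rgt0 // ltr0n lt0n.
Qed.

(* Otherwise x, which changes quadratically along the X-part of the orbit, would
   not be large both at its ends and at its middle: the sum of the two end points
   is bounded when the acceleration vanishes, since the Y-part acts as -1. *)
Lemma acceleration_neg r : (r < size X)%N ->
  sgl F (nth L X r) * (Mword pr (take r X) *m (N *m p)) 0 0 < 0.
Proof.
move=> rX; set J := nth L X r; set W := take r X.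
rewrite ltNge; apply/negP; set G := sgl F J * _ => G0.
pose l (z : 'cV[F]_2) := sgl F J * (Mword pr W *m z) 0 0.
have lD x y : l (x + y) = l x + l y by rewrite /l mulmxDr mxE mulrDr.
have lZ a x : l (a *: x) = a * l x by rewrite /l -scalemxAr mxE; ring.
have lx z : sgl F J * xword pr W z = l z + sgl F J * xword pr W 0.
  by rewrite xwordE mulrDr.
(* f is the part not involving G of the sum of the signed x at the block times i and k - i, and does
   not depend on k. Taking k at least 2 (trunc |b| + 2) gives |b| <= i - 1 for i = k./2, as
   [midpoint_le0] requires. *)
pose f := 2 * (sgl F J * xword pr W 0) + l ((b / 2) *: (N *m q) + q).
have [k hk [hX _]] := hlarge (1 + `|f|) (2 * (Num.truncn `|b|).+2).
pose i := (k./2)%N; have ki : (i + i <= k)%N by rewrite addnn -[X in (_ <= X)%N]odd_double_half leq_addl.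
have ki' : (k <= i + i + 1)%N.
  by rewrite -{1}[k](odd_double_half) addnn addnC leq_add2l; case: odd.
have i2 : ((Num.truncn `|b|).+2 <= i)%N.
  by rewrite /i -[X in (X <= _)%N]doubleK half_leq // -mul2n.
have bi : `|b| <= i%:R - 1.
  have /andP[_ h] := truncn_itv (normr_ge0 b).
  by rewrite lerBrDr (le_trans (_ : _ <= (Num.truncn `|b|).+1%:R + 1))
    ?lerD2r ?(ltW h) // natr1 ler_nat.
have i_k : (i < k)%N.
  by rewrite (leq_trans _ ki) // -[X in (X < _)%N]addn0 ltn_add2l (leq_trans _ i2).
have i_k' : (k - i < k)%N by rewrite ltn_subrL (leq_trans _ i_k) ?(leq_trans _ i2).
have h1 := hX i r i_k rX; have h2 := hX (k - i)%N r i_k' rX.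
rewrite -/J -/W lx in h1; rewrite -/J -/W lx in h2.
(* The orbit is quadratic in time, so the points at i and k - i add up to the two end points minus i
   (k - i) N p. The cycle equation with B = b N - 1 then determines the sum of the end points. *)
have e : l (iter i g (zk k)) + l (iter (k - i) g (zk k)) =
   (b * k%:R / 2 - i%:R * (k%:R - i%:R)) * G + l ((b / 2) *: (N *m q) + q).
  rewrite -lD -[G]/(l (N *m p)) -lZ -lD; congr (l _).
  have hz : zk k = b *: (N *m zk k + k%:R *: (N *m p)) - iter k g (zk k) + q.
    by have /is_cycle_powcat := cycle_unperturbed k; rewrite -/M -/p -/B -/q -/g BxE N_iter.
  have hz2 : zk k + iter k g (zk k) = b *: (N *m zk k + k%:R *: (N *m p)) + q.
    by rewrite {1}hz addrAC subrK.
  have -> : iter i g (zk k) + iter (k - i) g (zk k) =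
     zk k + iter k g (zk k) - (i%:R * (k%:R - i%:R)) *: (N *m p).
    rewrite !iter_unperturbed natrB ?(ltnW i_k) //.
    by apply/matrixP => i' j'; rewrite !mxE; field.
  rewrite hz2 N_zk; apply/matrixP => i' j'; rewrite !mxE; by field.
have kR : k%:R = i%:R + i%:R :> F \/ k%:R = i%:R + i%:R + 1 :> F.
  have [e'|e'] := eqVneq k (i + i)%N; [left|right]; first by rewrite {1}e' natrD.
  have -> : k = (i + i + 1)%N by apply/eqP; rewrite eqn_leq ki' addn1 ltn_neqAle eq_sym e' ki.
  by rewrite !natrD.
have iR : 1 <= i%:R :> F by rewrite ler1n (leq_trans _ i2).
have neg : b * k%:R / 2 - i%:R * (k%:R - i%:R) <= 0 by exact: (midpoint_le0 iR bi kR).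
have fE : f = 2 * (sgl F J * xword pr W 0) + l ((b / 2) *: (N *m q) + q) by [].
have := mulr_le0_ge0 neg G0; move: h1 h2 e (ler_norm f) (normr_ge0 f) fE.
move: (_ * G) (sgl F J * xword pr W 0) (l (_ + q)) (l _) (l _) `|f| (f) => *; lra.
Qed.

Lemma slope_pos_first r : (r < size X)%N ->
  0 < sgl F (nth L X r) * (Mword pr (take r X) *m zeta) 0 0.
Proof.
move=> rX; apply: (@slope_pos _ _ zk zeta zeta0) => // C.
by have [k k1 [h _]] := hlarge C 1; exists k; apply: (h 0%N).
Qed.

(** The end of the X-part is reached backwards through Y from the starting point. As det B = 1,
    [adj2 B] is the inverse of B, and the end point is affine in k as well. *)
Lemma slope_pos_right r : (r < size Y)%N ->
  0 < sgl F (nth L Y r) * (Mword pr (take r Y) *m (adj2 B *m zeta)) 0 0.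
Proof.
move=> rY; apply: (@slope_pos _ _ (fun k => iter k g (zk k)) (adj2 B *m zeta)
  (adj2 B *m (zeta0 - q))) => [k|C]; last first.
  by have [k k1 [_ h]] := hlarge C 1; exists k; apply: h.
have /is_cycle_powcat := cycle_unperturbed k; rewrite -/M -/p -/B -/q -/g => hz.
have -> : k%:R *: (adj2 B *m zeta) + adj2 B *m (zeta0 - q) = adj2 B *m (zk k - q).
  by rewrite scalemxAr -mulmxDr addrA.
rewrite -[in RHS]hz addrK mulmxA adj2_mul.
have -> : \det B = 1.
  have [_] := powcat_det_tr 0; rewrite Mword_powcat det_mulmx det_powV expr0 mulr1.
  by [].
by rewrite mul1mx.
Qed.

(** One block X further back: the start of the last copy of X, which is the right end of the window
    in [window_pos]. *)
Lemma slope_pos_last r : (r < size X)%N ->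
  0 < sgl F (nth L X r) * (Mword pr (take r X) *m (adj2 M *m (adj2 B *m zeta))) 0 0.
Proof.
move=> rX.
apply: (@slope_pos _ _ (fun k => adj2 M *m (iter k g (zk k) - p))
  (adj2 M *m (adj2 B *m zeta)) (adj2 M *m (adj2 B *m (zeta0 - q) - p))) => [k|C].
  have /is_cycle_powcat := cycle_unperturbed k; rewrite -/M -/p -/B -/q -/g => hz.
  rewrite scalemxAr -mulmxDr addrA; congr (_ *m (_ - p)).
  have -> : k%:R *: (adj2 B *m zeta) + adj2 B *m (zeta0 - q) = adj2 B *m (zk k - q).
    by rewrite scalemxAr -mulmxDr addrA.
  rewrite -[in RHS]hz addrK mulmxA adj2_mul.
  have -> : \det B = 1.
    have [_] := powcat_det_tr 0; rewrite Mword_powcat det_mulmx det_powV expr0 mulr1.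
    by [].
  by rewrite mul1mx.
have [[//|k] k1 [h _]] := hlarge C 1; exists k.+1.
have -> : adj2 M *m (iter k.+1 g (zk k.+1) - p) = iter k g (zk k.+1).
  by rewrite iterS {1}/g addrK mulmxA adj2_mul detM mul1mx.
exact: h.
Qed.

End Unperturbed.

(** * Attracting cycles exist when k is large and k^2 e is small *)

Section LowerBound.
Variable F : realType.
Variables (tL dL tR dR : F -> F) (m : F) (X Y : word).
Let P e := Params (tL e) (dL e) (tR e) (dR e) m.
Hypotheses (htL : derivable tL 0 1) (hdL : derivable dL 0 1)
  (htR : derivable tR 0 1) (hdR : derivable dR 0 1).
Hypothesis X0 : (0 < size X)%N.
Local Notation lk := (@largek F).
Let M e := Mword (P e) X.
Let B e := Mword (P e) Y.
Let p e := fword (P e) X 0.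
Let q e := fword (P e) Y 0.
Let g e (z : 'cV[F]_2) := M e *m z + p e.
Let s e := 1 - \tr (M e) + \det (M e).
Let d e := \det (M e).
Variables (a' b' b : F).
Hypotheses (a0 : 0 < a') (b0 : 0 < b').
Hypotheses (hs : s e / e @[e --> 0^'] --> a') (hd : (1 - d e) / e @[e --> 0^'] --> b').
Hypotheses (trM0 : \tr (M 0) = 2) (detM0 : \det (M 0) = 1).
Hypothesis hB0 : B 0 = b *: (M 0 - 1%:M) - 1%:M.
Let zeta := cycle_slope (M 0 - 1%:M) (p 0) (q 0) b.

Let dW W : mx_derivable (fun e => Mword (P e) W).
Proof. exact: mx_derivable_Mword. Qed.
Let df W : mx_derivable (fun e => fword (P e) W 0).
Proof. exact: mx_derivable_fword. Qed.

Let cvg_slope (Z : nat * F -> 'cV[F]_2) (z1 : 'cV[F]_2) :=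
  forall i, Z x i 0 / x.1%:R @[x --> lk] --> (z1 i 0 : F).

Let cvg_slope_xword W Z z1 : cvg_slope Z z1 ->
  xword (P x.2) W (Z x) / x.1%:R @[x --> lk] --> (Mword (P 0) W *m z1) 0 0.
Proof.
move=> hZ; apply: (@cvg_largek_eq _ _ (fun x => Mword (P x.2) W 0 0 * (Z x 0 0 / x.1%:R)
  + Mword (P x.2) W 0 1 * (Z x 1 0 / x.1%:R) + fword (P x.2) W 0 0 0 * x.1%:R^-1)).
  move=> x k0 e0; rewrite /xword fword_affine mxE mulmx2E; field.
  by rewrite gt_eqF.
rewrite [X in _ --> X](_ : _ = Mword (P 0) W 0 0 * z1 0 0 + Mword (P 0) W 0 1 * z1 1 0
  + fword (P 0) W 0 0 0 * 0); last by rewrite mulmx2E mulr0 addr0.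
apply: cvgD; last first.
  apply: cvgM; last exact: largek_kV.
  exact: (cvg_largek0 (mx_derivable_entry (df W))).
apply: cvgD; apply: cvgM (hZ _);
  exact: (cvg_largek0 (mx_derivable_entry (dW W))).
Qed.

Let cvg_slope_adj2 (A : F -> 'M[F]_2) (v : F -> 'cV[F]_2) Z z1 :
  mx_derivable A -> mx_derivable v -> \det (A 0) = 1 -> cvg_slope Z z1 ->
  cvg_slope (fun x => (\det (A x.2))^-1 *: (adj2 (A x.2) *m (Z x - v x.2)))
    (adj2 (A 0) *m z1).
Proof.
move=> hA hv dA hZ i; have hA' := mx_derivable_adj2 hA.
apply: (@cvg_largek_eq _ _ (fun x => (\det (A x.2))^-1 * (
   adj2 (A x.2) i 0 * (Z x 0 0 / x.1%:R - v x.2 0 0 * x.1%:R^-1)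
  + adj2 (A x.2) i 1 * (Z x 1 0 / x.1%:R - v x.2 1 0 * x.1%:R^-1)))).
  move=> x k0 e0; rewrite [in LHS]mxE mulmx2E.
  move: (\det (A x.2))^-1 (adj2 (A x.2)) (v x.2) (Z x) => D1 A1 v1 z2.
  by rewrite 4!mxE; field; rewrite gt_eqF.
rewrite [X in _ --> X](_ : _ = (\det (A 0))^-1 *
  (adj2 (A 0) i 0 * (z1 0 0 - v 0 0 0 * 0) + adj2 (A 0) i 1 * (z1 1 0 - v 0 1 0 * 0)));
  last by rewrite dA invr1 mul1r mulmx2E !mulr0 !subr0.
have hv' j : Z x j 0 / x.1%:R - v x.2 j 0 * x.1%:R^-1 @[x --> lk] --> z1 j 0 - v 0 j 0 * 0.
  apply: cvgB; first exact: hZ.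
  by apply: cvgM; [exact: (cvg_largek0 (mx_derivable_entry hv))|exact: largek_kV].
apply: cvgM.
  by apply: cvgV; [rewrite dA oner_eq0|exact: (cvg_largek0 (derivable_det2 hA))].
by apply: cvgD; apply: cvgM (hv' _); exact: (cvg_largek0 (mx_derivable_entry hA')).
Qed.

Lemma xword_gt0 W (c : F) Z z1 : cvg_slope Z z1 ->
  0 < c * (Mword (P 0) W *m z1) 0 0 ->
  \forall x \near lk, 0 < c * xword (P x.2) W (Z x).
Proof.
move=> hZ c0.
have h : c * (xword (P x.2) W (Z x) / x.1%:R) @[x --> lk] --> c * (Mword (P 0) W *m z1) 0 0.
  by apply: cvgM; [exact: cvg_cst|exact: cvg_slope_xword].
have hp : \forall x \near lk, 0 < c * (xword (P x.2) W (Z x) / x.1%:R).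
  exact: (cvgr_gt _ h).
near=> x.
have : 0 < c * (xword (P x.2) W (Z x) / x.1%:R).
  by near: x; exact: hp.
rewrite mulrA pmulr_lgt0 // invr_gt0.
by near: x; apply: filterS (@largek_pos F) => ? [].
Unshelve. all: by end_near. Qed.

(** The constant forcing of the recurrence for x after W. The second term comes from the translation
    part c of W, since c - (1 + d - s) c + d c = s c. *)
Definition acceleration W e : F :=
  (Mword (P e) W *m (p e - adj2 (M e) *m p e)) 0 0 + xword (P e) W 0 * s e.

Lemma acceleration_rec W e z j :
  let w j := xword (P e) W (iter j (g e) z) in
  w j.+2 = (1 + d e - s e) * w j.+1 - d e * w j + acceleration W e.
Proof.
move=> /=; rewrite /xword !(fword_affine _ _ (_ + p e)) (fword_affine _ _ (iter j _ z)).
rewrite /acceleration /xword; move: (iter j (g e) z) => y.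
have e1 : g e (g e y) = (1 + d e - s e) *: g e y - d e *: y + (p e - adj2 (M e) *m p e).
  by rewrite /g affine_second_iterate /d /s; congr (_ *: _ - _ + _); ring.
have -> : M e *m g e y + p e = g e (g e y) by [].
have -> : M e *m y + p e = g e y by [].
rewrite e1; move: (g e y) (p e - _) => y1 y2.
rewrite !mulmxDr !mulmxN -!scalemxAr.
move: (_ *m y) (_ *m y1) (_ *m y2) => v v1 v2.
by move: (fword (P e) W 0) => c; rewrite !mxE; ring.
Qed.

Lemma cvg_acceleration W :
  derivable (acceleration W) 0 1 /\
  acceleration W 0 = (Mword (P 0) W *m ((M 0 - 1%:M) *m p 0)) 0 0.
Proof.
split.
  have h1 : mx_derivable (fun e => adj2 (M e) *m p e) :=
    mx_derivableM (mx_derivable_adj2 (dW X)) (df X).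
  have h2 := mx_derivableM (dW W) (mx_derivableB (df X) h1).
  have h3 : derivable (fun e => (Mword (P e) W *m (p e - adj2 (M e) *m p e)) 0 0) 0 1 :=
    mx_derivable_entry h2.
  have h4 : derivable (fun e => xword (P e) W 0) 0 1 := mx_derivable_entry (df W).
  have h5 : derivable s 0 1.
    apply: derivableD; last exact: (derivable_det2 (dW X)).
    by apply: derivableB; [exact: (derivable_cst (1 : F))|exact: (derivable_tr2 (dW X))].
  exact: (derivableD h3 (derivableM h4 h5)).
rewrite /acceleration /s trM0 detM0 (_ : 1 - 2 + 1 = 0) ?mulr0 ?addr0; last by ring.
congr ((_ *m _) 0 0); rewrite /adj2 trM0 -[X in X - _]mul1mx -mulmxBl.
by congr (_ *m _); apply/matrixP => i j; rewrite !mxE; ring.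
Qed.

Hypothesis hlarge : large_cycles (P 0) X Y b.

(** Z1, Z2 and Z3 are the start of the cycle, the end of its X-part, and the start of the last X.
    The latter two are computed backwards from Z1, so their limits involve one application of Y or X
    instead of k iterations. *)
Let Z1 := cycle_base M B p q.
Let Z2 x := (\det (B x.2))^-1 *: (adj2 (B x.2) *m (Z1 x - q x.2)).
Let Z3 x := (\det (M x.2))^-1 *: (adj2 (M x.2) *m (Z2 x - p x.2)).

Let detB0 : \det (B 0) = 1. Proof. exact: (det_B0 hB0 trM0 detM0). Qed.

Let hZ1 : cvg_slope Z1 zeta.
Proof. exact: (cvg_cycle_base (dW X) (dW Y) (df X) (df Y) a0 b0 hs hd hB0 trM0 detM0). Qed.
Let hZ2 : cvg_slope Z2 (adj2 (B 0) *m zeta).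
Proof. exact: (cvg_slope_adj2 (dW Y) (df Y) detB0 hZ1). Qed.
Let hZ3 : cvg_slope Z3 (adj2 (M 0) *m (adj2 (B 0) *m zeta)).
Proof. exact: (cvg_slope_adj2 (dW X) (df X) detM0 hZ2). Qed.

Lemma attracting_exists : \forall x \near lk,
  exists z, attracting_cycle (P x.2) (powcat X Y x.1) z.
Proof.
pose A x := B x.2 *m powV (M x.2) x.1.
have j1 : \forall x \near lk, 0 < (1 + \tr (A x) + \det (A x)) / (x.1%:R ^+ 2 * x.2).
  by apply: (cvgr_gt _ (@cvg_jury1 F M B b a' b' (dW X) (dW Y) a0 b0 hs hd hB0 trM0 detM0)).
have j2 : \forall x \near lk, 0 < (1 - \det (A x)) / (x.1%:R * x.2).
  by apply: (cvgr_gt _ (@cvg_jury2 F M B b a' b' (dW Y) a0 b0 hs hd hB0 trM0 detM0)).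
have j3 : \forall x \near lk, 0 < 1 - \tr (A x) + \det (A x).
  by apply: (cvgr_gt _ (@cvg_jury3 F M B b a' b' (dW X) (dW Y) a0 b0 hs hd hB0 trM0 detM0)).
have hsd := largek_sd a0 b0 hs hd.
have eta1 : \forall x \near lk,
    0 < 1 - (s x.2 * x.1%:R ^+ 2 + (1 - d x.2) * x.1%:R) :> F.
  have : 1 - (s x.2 * x.1%:R ^+ 2 + (1 - d x.2) * x.1%:R) @[x --> lk] --> 1 - (0 + 0 : F).
    apply: cvgB; first exact: cvg_cst.
    by apply: cvgD; [exact: (largek_sk2 hs)|exact: (largek_dk hd)].
  by move/cvgr_gt; apply; rewrite addr0 subr0.
(* Only finitely many limit conditions are intersected, one family per letter of X; the k
   repetitions of X are left to [window_pos]. *)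
have hX : \forall x \near lk, forall r : 'I_(size X),
    [/\ sgl F (nth L X r) * acceleration (take r X) x.2 < 0,
        0 < sgl F (nth L X r) * xword (P x.2) (take r X) (Z1 x) &
        0 < sgl F (nth L X r) * xword (P x.2) (take r X) (Z3 x)].
  apply: filter_forall => r; near=> x; split; near: x.
  - have [h1 h2] := cvg_acceleration (take r X).
    have : sgl F (nth L X r) * acceleration (take r X) x.2 @[x --> lk] -->
        sgl F (nth L X r) * acceleration (take r X) 0.
      by apply: cvgM; [exact: cvg_cst|exact: cvg_largek0 h1].
    move/cvgr_lt; apply; rewrite h2.
    exact: (acceleration_neg trM0 detM0 hB0 hlarge).
  - apply: (xword_gt0 hZ1).
    exact: (slope_pos_first hlarge).
  - apply: (xword_gt0 hZ3).
    exact: (slope_pos_last trM0 detM0 hB0 hlarge).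
have hY : \forall x \near lk, forall r : 'I_(size Y),
    0 < sgl F (nth L Y r) * xword (P x.2) (take r Y) (Z2 x).
  apply: filter_forall => r; apply: (xword_gt0 hZ2).
  exact: (slope_pos_right trM0 detM0 hB0 hlarge).
have dBn : \forall x \near lk, 0 < \det (B x.2).
  have := cvg_largek0 (derivable_det2 (dW Y)).
  by move/cvgr_gt; apply; rewrite -/(B 0) detB0.
near=> x; exists (Z1 x).
have [k0 e0 s0 d01 sk] : [/\ 0 < x.1%:R :> F, 0 < x.2, 0 < s x.2,
  0 < d x.2 < 1 & s x.2 * x.1%:R ^+ 2 <= 1] by near: x.
have detB : 0 < \det (B x.2) by near: x.
have hXx : forall r : 'I_(size X),
    [/\ sgl F (nth L X r) * acceleration (take r X) x.2 < 0,
        0 < sgl F (nth L X r) * xword (P x.2) (take r X) (Z1 x) &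
        0 < sgl F (nth L X r) * xword (P x.2) (take r X) (Z3 x)] by near: x.
have hYx : forall r : 'I_(size Y),
    0 < sgl F (nth L Y r) * xword (P x.2) (take r Y) (Z2 x) by near: x.
have eta0 : 0 < 1 - (s x.2 * x.1%:R ^+ 2 + (1 - d x.2) * x.1%:R) by near: x.
have j1x : 0 < (1 + \tr (A x) + \det (A x)) / (x.1%:R ^+ 2 * x.2) by near: x.
have j2x : 0 < (1 - \det (A x)) / (x.1%:R * x.2) by near: x.
have j3x : 0 < 1 - \tr (A x) + \det (A x) by near: x.
rewrite /A in j1x j2x j3x.
set k := x.1 in k0 sk eta0 j1x j2x j3x *.
set e := x.2 in e0 s0 d01 sk detB hXx hYx eta0 j1x j2x j3x *.
have /andP[d0 d1] := d01.
have kpos : (0 < k)%N by move: k0; rewrite ltr0n.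
have hA : Mword (P e) (powcat X Y k) = B e *m powV (M e) k by exact: Mword_powcat.
have D0 : 0 < 1 - \tr (Mword (P e) (powcat X Y k)) + \det (Mword (P e) (powcat X Y k)).
  by rewrite hA.
have hcyc : is_cycle (P e) (powcat X Y k) (Z1 x).
  have := cycle_solution (lt0r_neq0 D0); rewrite hA; congr is_cycle.
  rewrite /Z1 /cycle_base -/k -/e; congr (_ *: (_ *m _)).
  rewrite fword_cat fword_nseq iter_affine fword_affine !mulmx0 !scaler0 !add0r.
  by [].
have hz2 : iter k (g e) (Z1 x) = Z2 x.
  have /is_cycle_powcat h := hcyc; rewrite /Z2 -/e -[in RHS]h addrK mulmxA adj2_mul.
  by rewrite mul_scalar_mx scalerA mulVf ?gt_eqF // scale1r.
have hz3 : iter k.-1 (g e) (Z1 x) = Z3 x.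
  rewrite /Z3 -hz2 -/e -{2}(prednK kpos) iterS {2}/g addrK mulmxA adj2_mul.
  by rewrite mul_scalar_mx scalerA mulVf ?gt_eqF // scale1r.
have [hadm hoff] : admissible (P e) (powcat X Y k) (Z1 x) /\
    off_switching (P e) (powcat X Y k) (Z1 x).
  apply/strict_powcatP => //; split=> [j r jk rX|r rY]; last first.
    by rewrite -/(p e) -/(M e) -/(g e) hz2; have := hYx (Ordinal rY).
  have [h1 h2 h3] := hXx (Ordinal rX); rewrite /= in h1 h2 h3.
  rewrite -/(p e) -/(M e) -/(g e).
  pose w j := sgl F (nth L X r) * xword (P e) (take r X) (iter j (g e) (Z1 x)).
  apply: (@window_pos F (s e) (d e) (- (sgl F (nth L X r) * acceleration (take r X) e)) w k.-1) => //.
  - by rewrite oppr_ge0 ltW.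
  - by move=> i; rewrite /w acceleration_rec; ring.
  - move=> i /andP[i0 ik].
    have ik' : (i <= k)%N by rewrite (leq_trans ik) // leq_pred.
    have [_ _ + _] := coef_bounds_unif (d := d) (x := x) ik' s0 d01 sk.
    by apply: lt_le_trans; rewrite mulr_gt0 // ltr0n.
  - by rewrite /w hz3.
  - by rewrite -ltnS prednK.
split=> //; apply: jury_criterion; rewrite // hA.
- by move: j2x; rewrite pmulr_lgt0 ?invr_gt0 ?mulr_gt0 // subr_gt0.
- by move: j1x; rewrite pmulr_lgt0 ?invr_gt0 ?mulr_gt0 ?exprn_gt0.
Unshelve. all: by end_near. Qed.

End LowerBound.

(** * No admissible cycles when k^2 e is large *)

Section UpperBound.
Variable F : realType.
Variables (tL dL tR dR : F -> F) (m : F) (X Y : word).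
Let P e := Params (tL e) (dL e) (tR e) (dR e) m.
Hypotheses (htL : derivable tL 0 1) (hdL : derivable dL 0 1)
  (htR : derivable tR 0 1) (hdR : derivable dR 0 1).
Hypothesis X0 : (0 < size X)%N.
Let M e := Mword (P e) X.
Let s e := 1 - \tr (M e) + \det (M e).
Let d e := \det (M e).
Variables (a' b' b : F).
Hypothesis a0 : 0 < a'.
Hypotheses (hs : s e / e @[e --> 0^'] --> a') (hd : (1 - d e) / e @[e --> 0^'] --> b').
Hypotheses (trM0 : \tr (M 0) = 2) (detM0 : \det (M 0) = 1).
Hypothesis hB0 : Mword (P 0) Y = b *: (M 0 - 1%:M) - 1%:M.
Hypothesis hlarge : large_cycles (P 0) X Y b.

Let dM : mx_derivable M.
Proof. exact: (mx_derivable_Mword m htL hdL htR hdR X). Qed.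

Let cd : d e @[e --> 0^'] --> (1 : F).
Proof. by rewrite -detM0; exact: (derivable_cvg0 (derivable_det2 dM)). Qed.

Let cs : s e @[e --> 0^'] --> (0 : F).
Proof.
rewrite [X in _ --> X](_ : 0 = 1 - \tr (M 0) + \det (M 0)); last first.
  by rewrite trM0 detM0; ring.
apply: cvgD; last exact: (derivable_cvg0 (derivable_det2 dM)).
by apply: cvgB; [exact: cvg_cst|exact: (derivable_cvg0 (derivable_tr2 dM))].
Qed.

(** The squared sine of the rotation angle in [coefU_le0]. Its numerator is 4 d - (1 + d - s)^2 = 2
    s (1 + d) - s^2 - (1 - d)^2, whose leading term is 4 a' e. *)
Let disc e := 1 - (1 + d e - s e) ^+ 2 / (4 * d e).

Let cvg_disc : disc e / e @[e --> 0^'] --> a'.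
Proof.
have h : (2 * (s e / e) * (1 + d e) - s e * (s e / e) - (1 - d e) / e * (1 - d e))
    / (4 * d e) @[e --> 0^'] --> a'.
  rewrite [X in _ --> X](_ : a' = (2 * a' * (1 + 1) - 0 * a' - b' * (1 - 1)) / (4 * 1));
    last by field.
  apply: cvgM; last first.
    apply: cvgV; first by rewrite mulr1 pnatr_eq0.
    by apply: cvgM cd; exact: cvg_cst.
  apply: cvgB; last by apply: cvgM hd _; apply: cvgB cd; exact: cvg_cst.
  apply: cvgB; last exact: cvgM cs hs.
  apply: cvgM; first by apply: cvgM hs; exact: cvg_cst.
  by apply: cvgD cd; exact: cvg_cst.
apply: cvg_trans h; apply: near_eq_cvg; near=> e.
have e0 : e != 0 by near: e; exact: nbhs_dnbhs_neq.
have d0 : d e != 0 by near: e; apply: cvgr_neq0 cd _; exact: oner_neq0.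
by rewrite /disc; field; rewrite e0 d0.
Unshelve. all: by end_near. Qed.

Lemma admissible_bound : exists e1 C : F, [/\ 0 < e1, 0 < C &
  forall e k z, 0 < e <= e1 ->
    admissible (P e) (powcat X Y k) z /\ off_switching (P e) (powcat X Y k) z ->
    k%:R ^+ 2 * e <= C].
Proof.
pose acc e := sgl F (nth L X 0) * acceleration tL dL tR dR m X (take 0 X) e.
have hacc : \forall e \near (0 : F)^', acc e < 0.
  have [h1 h2] := cvg_acceleration htL hdL htR hdR trM0 detM0 (take 0 X).
  have : acc e @[e --> 0^'] --> acc 0.
    by apply: cvgM; [exact: cvg_cst|exact: derivable_cvg0 h1].
  move/cvgr_lt; apply; rewrite /acc h2.
  exact: (acceleration_neg trM0 detM0 hB0 hlarge).
have hdisc : \forall e \near (0 : F)^', a' / 2 < disc e / e.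
  by apply: (cvgr_gt _ cvg_disc); rewrite ltr_pdivrMr // ltr_pMr // ltr1n.
have hd0 : \forall e \near (0 : F)^', 0 < d e by apply: (cvgr_gt _ cd).
have : \forall e \near (0 : F)^', [/\ acc e < 0, a' / 2 < disc e / e & 0 < d e].
  by near=> e; split; near: e.
move=> [r /= r0 hr].
(* Half a turn gives (k - 1)^2 disc <= pi^2, and disc > a' e / 2. With k^2 <= 2 (k - 1)^2 + 2 and 2
   e <= r this yields the constant. *)
exists (r / 2), (4 * pi ^+ 2 / a' + r); split; first by rewrite divr_gt0.
  by rewrite addr_gt0 // divr_gt0 // mulr_gt0 // exprn_gt0 // pi_gt0.
move=> e k z /andP[e0 er] /(strict_powcatP _ _ _ _ X0) [hX _].
have [h1 h2 h3] : [/\ acc e < 0, a' / 2 < disc e / e & 0 < d e].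
  apply: hr; rewrite /= ?gt_eqF // sub0r normrN gtr0_norm //.
  by rewrite (le_lt_trans er) // ltr_pdivrMr // ltr_pMr // ltr1n.
have disc0 : a' / 2 * e < disc e by rewrite -ltr_pdivlMr.
have disc_gt0 : 0 < disc e.
  by apply: lt_trans disc0; rewrite mulr_gt0 // divr_gt0.
have ht : (1 + d e - s e) ^+ 2 < 4 * d e.
  by move: disc_gt0; rewrite subr_gt0 ltr_pdivrMr ?mul1r // mulr_gt0.
have [J [J0 UJ hJ]] := coefU_le0 h3 ht.
pose w j := sgl F (nth L X 0) * xword (P e) (take 0 X)
  (iter j (fun z => M e *m z + fword (P e) X 0) z).
have kJ : (k <= J)%N.
  apply: (@window_bound F (s e) (d e) (- acc e) w k J) => //.
  - exact: ltW.
  - by rewrite oppr_gt0.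
  - move=> j; rewrite /w /acc.
    have /= -> := @acceleration_rec F tL dL tR dR m X (take 0 X) e z j.
    by rewrite -/(P e) -/(M e) -/(s e) -/(d e); ring.
  - by move=> j jk; apply/ltW/hX.
rewrite -/(disc e) in hJ.
have sd : 0 < Num.sqrt (disc e) by rewrite sqrtr_gt0.
have hk : k%:R - 1 <= pi / Num.sqrt (disc e).
  by rewrite lerBlDr (le_trans _ hJ) // ler_nat.
have [->|k0] := eqVneq k 0%N.
  by rewrite expr0n mul0r addr_ge0 ?(ltW r0) // divr_ge0 ?(ltW a0) // mulr_ge0 // exprn_ge0 // pi_ge0.
have k1 : 0 <= k%:R - 1 :> F by rewrite subr_ge0 ler1n lt0n.
have h4 : (k%:R - 1) ^+ 2 * disc e <= pi ^+ 2.
  rewrite -(sqr_sqrtr (ltW disc_gt0)) -exprMn ler_pXn2r ?nnegrE ?pi_ge0 //.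
    by rewrite -ler_pdivlMr.
  by rewrite mulr_ge0 // ltW.
have h5 : (k%:R - 1) ^+ 2 * (a' / 2 * e) <= pi ^+ 2.
  by apply: le_trans h4; rewrite ler_wpM2l ?sqr_ge0 // ltW.
have h6 : (k%:R - 1) ^+ 2 * e <= 2 * pi ^+ 2 / a'.
  by rewrite ler_pdivlMr //; lra.
have h7 : k%:R ^+ 2 <= 2 * (k%:R - 1) ^+ 2 + 2 :> F.
  by rewrite -subr_ge0 (_ : _ - _ = (k%:R - 2) ^+ 2) ?sqr_ge0 //; ring.
have h8 : k%:R ^+ 2 * e <= (2 * (k%:R - 1) ^+ 2 + 2) * e by rewrite ler_wpM2r // ltW.
lra.
Unshelve. all: by end_near. Qed.

End UpperBound.

(** * Consequences of the hypotheses at e = 0 *)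

Section Setup.
Variable F : realType.

Lemma infinite_nat_ge (A : set nat) : infinite_set A ->
  forall K, exists2 k, (K <= k)%N & A k.
Proof.
move=> Ainf K; apply: contrapT => h; apply: Ainf; apply: sub_finite_set (finite_II K).
move=> k Ak; rewrite /= ltnNge; apply/negP => Kk; apply: h; by exists k.
Qed.

Lemma unbounded_infinite (A : set nat) :
  (forall K, exists2 k, (K <= k)%N & A k) -> infinite_set A.
Proof.
move=> h /finite_seqP[S AS]; have [k] := h (\max_(i <- S) i).+1.
rewrite AS /= => + kS; by rewrite ltnNge (leq_bigmax_seq _ kS).
Qed.

Variables (pr : params F) (X Y : word).
Hypotheses (dL1 : deltaL pr = 1) (dR1 : deltaR pr = 1) (X0 : (0 < size X)%N).
Hypothesis hM : repeated_unit_eigenvalue_geom1 (Mword pr X).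
Hypothesis hinf : infinite_set [set k : nat | (1 <= k)%N /\ exists z : 'cV[F]_2,
    unique_cycle pr (powcat X Y k) z /\ stable_cycle pr (powcat X Y k) z].
Let M := Mword pr X.
Let N := M - 1%:M.

Lemma repeated_tr_det : \tr M = 2 /\ \det M = 1.
Proof.
have [] := hM; rewrite -/M char_poly2 => /polyP hp _.
have := hp 1%N; have := hp 0%N.
have -> : ('X - 1%:P) ^+ 2 = 'X^2 - 2 *: 'X + 1%:P :> {poly F}.
  by rewrite -mul_polyC polyCMn; ring.
rewrite !coefD !coefN !coefZ !coefXn !coefX !coefC /= !mulr0 !mulr1 !addr0 !add0r.
by move=> hd ht; split; lra.
Qed.

Lemma repeated_sub1_neq0 : N != 0.
Proof.
have [_] := hM; apply: contra_eq_neq => h.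
by rewrite /eigenspace -/M -/N h mxrank_ker mxrank0.
Qed.

Lemma unperturbed_structure : exists b, Mword pr Y = b *: N - 1%:M.
Proof.
have [trM detM] := repeated_tr_det.
have trN : \tr N = 0 by rewrite raddfB /= mxtrace1 trM subrr.
have detN : \det N = 0.
  have -> : \det N = \det M - \tr M + 1 by rewrite !det2E tr2E !mxE /=; ring.
  by rewrite detM trM; ring.
have trS k : \tr (Mword pr (powcat X Y k)) =
    \tr (Mword pr Y) + k%:R * \tr (Mword pr Y *m N).
  rewrite Mword_powcat -/M /powV trM detM (_ : 1 - 2 + 1 = 0); last by ring.
  by rewrite !coef00 scale1r mulmxDr mulmx1 -scalemxAr mxtraceD mxtraceZ.
have hS K : exists2 k, (K <= k)%N & -2 <= \tr (Mword pr (powcat X Y k)) <= 2 /\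
    \tr (Mword pr (powcat X Y k)) != 2.
  have [k Kk [_ [z [hu [_ _ _ hst]]]]] := infinite_nat_ge hinf K; exists k => //.
  split; first exact: eigenvalueC_le1_tr.
  have := unique_cycle_det hu; rewrite det_Mword1 //; apply: contra => /eqP ->.
  by apply/eqP; ring.
have trBN : \tr (Mword pr Y *m N) = 0.
  apply/eqP/negP => /negP c0; set c := \tr (_ *m N) in c0 trS.
  have cn : 0 < `|c| by rewrite normr_gt0.
  (* For such k, k |c| exceeds |tr M_Y| + 3, so the trace, affine in k, leaves [-2, 2]. *)
  have [k hk [+ _]] := hS (Num.truncn ((`|\tr (Mword pr Y)| + 3) / `|c|)).+1.
  rewrite trS -/c => hb.
  have q0 : 0 <= (`|\tr (Mword pr Y)| + 3) / `|c| by rewrite divr_ge0 // addr_ge0.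
  have /andP[_ h1] := truncn_itv q0.
  have h2 : (`|\tr (Mword pr Y)| + 3) / `|c| < k%:R by rewrite (lt_le_trans h1) // ler_nat.
  rewrite ltr_pdivrMr // in h2.
  have h3 : `|\tr (Mword pr Y) + k%:R * c| <= 2 by rewrite ler_norml.
  have h4 : `|k%:R * c| <= `|\tr (Mword pr Y) + k%:R * c| + `|\tr (Mword pr Y)|.
    by rewrite -{1}[k%:R * c](addKr (\tr (Mword pr Y))) addrC (le_trans (ler_normB _ _)).
  rewrite normrM normr_nat in h4; lra.
have [k _ [h1 h2]] := hS 0%N; rewrite trS trBN mulr0 addr0 in h1 h2.
exact: (reflection_structure repeated_sub1_neq0 trN detN (det_Mword1 Y dL1 dR1) trBN h1 h2).
Qed.

(** Uniqueness identifies the given cycle with [cycle_start]; admissibility supplies the signs, and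
    the divergence of the minimum supplies the size. *)
Lemma large_cycles_unperturbed b : Mword pr Y = b *: N - 1%:M ->
  (forall C : F, \forall k \near \oo, forall z : 'cV[F]_2,
    unique_cycle pr (powcat X Y k) z ->
    forall i : nat, (i < size (powcat X Y k))%N ->
    C <= `|cycle_x pr (powcat X Y k) z i|) ->
  large_cycles pr X Y b.
Proof.
move=> hB hmin C K; have [trM detM] := repeated_tr_det.
have [K1 _ hK1] := hmin C.
have [k hk [_ [z [hu hst]]]] := infinite_nat_ge hinf (maxn K K1).
move: hk; rewrite geq_max => /andP[Kk K1k]; exists k => //.
have hz : z = cycle_start pr X Y b k.
  by apply: (unique_cycle_unperturbed trM detM hB k).2; case: hu.
case: hst => _ hadm hoff _.
have /(strict_powcatP _ _ _ _ X0)[hX hY] := conj hadm hoff.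
have [hX' hY'] := cycle_x_powcat X0 (hK1 k K1k z hu).
have hsgl J (x : F) : 0 < sgl F J * x -> C <= `|x| -> C <= sgl F J * x.
  move=> h; suff -> : sgl F J * x = `|x| by [].
  rewrite -(gtr0_norm h) normrM.
  by case: J h => _ /=; rewrite ?normrN normr1 mul1r.
rewrite -hz; split=> [j r jk rX|r rY]; apply: hsgl.
- exact: hX.
- exact: hX'.
- exact: hY.
- exact: hY'.
Qed.

End Setup.

(** * Counting *)

Section Counting.
Variable F : realType.
Variables (P : F -> params F) (X Y : word).

Lemma attracting_cycles_fst_inj e :
  {in attracting_cycles (P e) X Y &, injective (@fst nat 'cV[F]_2)}.
Proof.
move=> [k z] [k' z'] /set_mem /= [_ [h1 _ _ h2]] /set_mem /= [_ [h1' _ _ _]] e1.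
rewrite e1; congr pair; rewrite /= in e1; rewrite -e1 in h1'.
exact: (is_cycle_uniq (eigenvalueC_lt1_sub h2) h1 h1').
Qed.

Lemma kappa_bounds (k0 : nat) (c e1 C : F) : 0 < c -> 0 < e1 -> 0 < C ->
  (forall k e, (k0 <= k)%N -> 0 < e -> k%:R ^+ 2 * e <= c ->
     exists z, attracting_cycle (P e) (powcat X Y k) z) ->
  (forall e k z, 0 < e <= e1 ->
     admissible (P e) (powcat X Y k) z /\ off_switching (P e) (powcat X Y k) z ->
     k%:R ^+ 2 * e <= C) ->
  exists estar lo hi : F, [/\ 0 < estar, 0 < lo & forall e, 0 < e <= estar ->
    exists n, [/\ kappa_is P X Y e n, (1 <= n)%N & lo <= n%:R ^+ 2 * e <= hi]].
Proof.
move=> c0 e10 C0 hlo hup; pose k1 := maxn k0 1.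
have k10 : (0 < k1)%N by rewrite leq_max orbT.
have k1R : 1 <= k1%:R :> F by rewrite ler1n.
(* The second bound on e means sqrt (c / e) >= 2 k1, so discarding the k below k1 costs at most half
   of the lower count: n >= sqrt (c / e) / 2. The last constant comes from n <= sqrt (C / e) + 1 and
   (x + 1)^2 <= 2 x^2 + 2. *)
exists (Num.min e1 (c / (4 * k1%:R ^+ 2))), (c / 4), (2 * C + 2 * e1); split.
- by rewrite lt_min e10 divr_gt0 // mulr_gt0 // exprn_gt0 // ltr0n.
- by rewrite divr_gt0.
move=> e /andP[e0]; rewrite le_min => /andP[ee1 ec].
pose A := attracting_cycles (P e) X Y.
pose B := fst @` A.
have BA : (B #= A)%card by apply: inj_card_eq; exact: attracting_cycles_fst_inj.
have q0 : 0 <= Num.sqrt (C / e) by exact: sqrtr_ge0.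
have /andP[N1 N2] := truncn_itv q0.
set N := Num.truncn (Num.sqrt (C / e)) in N1 N2.
have BN : B `<=` `I_N.+1.
  move=> _ [[k z] /= [_ [_ h1 h2 _]] <-] /=; rewrite ltnS -ltnS -(ltr_nat F).
  apply: le_lt_trans N2; rewrite -(ger0_norm (ler0n F k)) -sqrtr_sqr.
  rewrite ler_sqrt ?divr_ge0 ?(ltW C0) ?(ltW e0) // ler_pdivlMr //.
  by apply: hup (conj h1 h2); rewrite e0.
have /finite_setP[n hn] := sub_finite_set BN (finite_II _).
have nN : (n <= N.+1)%N.
  by rewrite -card_le_II -(card_le_eql hn) subset_card_le.
have s0 : 0 <= Num.sqrt (c / e) by exact: sqrtr_ge0.
have /andP[M1 M2] := truncn_itv s0.
set m := Num.truncn (Num.sqrt (c / e)) in M1 M2.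
(* Every k from k1 to m carries an attracting cycle; k1 >= 1 because S[k] is only counted for k >=
   1. *)
have mB : [set (i + k1)%N | i in `I_(m.+1 - k1)] `<=` B.
  move=> _ [i /= hi <-].
  have ik : (i + k1 <= m)%N by move: hi; rewrite ltn_subRL ltnS addnC.
  have [z hz] : exists z, attracting_cycle (P e) (powcat X Y (i + k1)) z.
    apply: hlo => //; first by rewrite (leq_trans _ (leq_addl _ _)) // leq_maxl.
    rewrite -ler_pdivlMr // -(sqr_sqrtr (_ : 0 <= c / e)) ?divr_ge0 ?(ltW c0) ?(ltW e0) //.
    by rewrite ler_pXn2r ?nnegrE // (le_trans _ M1) // ler_nat.
  by exists ((i + k1)%N, z) => //; split => //=; rewrite (leq_trans k10) ?leq_addl.
have mn : (m.+1 - k1 <= n)%N.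
  rewrite -card_le_II -(card_le_eqr hn).
  apply: card_le_trans (subset_card_le mB).
  by rewrite (card_le_eqr (inj_card_eq _)) // => i j _ _ /addIn.
have sq1 : 2 * k1%:R <= Num.sqrt (c / e).
  rewrite -(ger0_norm (_ : 0 <= 2 * k1%:R)) ?mulr_ge0 // -sqrtr_sqr ler_sqrt; last first.
    by rewrite divr_ge0 // ltW.
  rewrite ler_pdivlMr // exprMn; move: ec; rewrite ler_pdivlMr ?mulr_gt0 ?exprn_gt0 ?ltr0n //.
  by rewrite (_ : 2 ^+ 2 = 4 :> F) 1?mulrC // -natrX.
have mR : Num.sqrt (c / e) <= n%:R + k1%:R.
  by rewrite -natrD (le_trans (ltW M2)) // ler_nat addnC -leq_subLR.
have nR : Num.sqrt (c / e) / 2 <= n%:R by lra.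
have nR' : n%:R <= Num.sqrt (C / e) + 1.
  by rewrite (le_trans (_ : _ <= N.+1%:R)) ?ler_nat // -natr1 lerD2r.
have n1 : (1 <= n)%N by rewrite -(ler1n F); lra.
have ce : c / e = Num.sqrt (c / e) ^+ 2 by rewrite sqr_sqrtr // divr_ge0 // ltW.
have Ce : C / e = Num.sqrt (C / e) ^+ 2 by rewrite sqr_sqrtr // divr_ge0 // ltW.
exists n; split=> //.
  by rewrite /kappa_is -/A -(card_eql BA).
apply/andP; split.
  rewrite -ler_pdivrMr // mulrAC ce; set x := Num.sqrt _ in s0 nR *; nra.
rewrite -ler_pdivlMr // mulrDl -mulrA Ce.
have : 1 <= e1 / e by rewrite ler_pdivlMr // mul1r.
rewrite -mulrA; set y := e1 / e; set x := Num.sqrt _ in q0 nR' *.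
have n0 : 0 <= n%:R :> F by [].
have x2 : n%:R ^+ 2 <= (x + 1) ^+ 2 by rewrite ler_pXn2r ?nnegrE // addr_ge0.
have : 0 <= (x - 1) ^+ 2 by exact: sqr_ge0.
by nra.
Qed.

End Counting.

(** * First order quotients from the expansions of determinant and trace *)

Section Quotients.
Variable F : realType.

Lemma bigO_sqr_quot (f : F -> F) : f =O_ (0 : F) (fun e : F => e ^+ 2) ->
  f e / e @[e --> 0^'] --> (0 : F).
Proof.
move=> /eqO_exP[C C0 hC]; apply/cvgrPdist_le => /= r r0.
have : \forall e \near (0 : F)^', `|f e| <= C * `|e ^+ 2| by exact: cvg_within hC.
move=> hC'; near=> e.
have e0 : e != 0 by near: e; exact: nbhs_dnbhs_neq.
have h : `|f e| <= C * `|e ^+ 2| by near: e.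
have er : `|e| < r / C.
  near: e; apply: cvg_within; apply: (@nbhs0_lt F F); exact: divr_gt0.
rewrite sub0r normrN normrM normfV ler_pdivrMr ?normr_gt0 // (le_trans h) //.
rewrite normrX expr2 mulrA ler_wpM2r // mulrC -ler_pdivlMr //.
exact: ltW.
Unshelve. all: by end_near. Qed.

Lemma bigO_sqr_linear (f : F -> F) (u v : F) :
  (fun e : F => f e - (u + v * e)) =O_ (0 : F) (fun e : F => e ^+ 2) ->
  (f e - u) / e @[e --> 0^'] --> v.
Proof.
move=> /bigO_sqr_quot h.
have : (f e - (u + v * e)) / e + v @[e --> 0^'] --> 0 + v.
  by apply: cvgD => //; exact: cvg_cst.
rewrite add0r; apply: cvg_trans; apply: near_eq_cvg; near=> e.
have e0 : e != 0 by near: e; exact: nbhs_dnbhs_neq.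
by field.
Unshelve. all: by end_near. Qed.

End Quotients.

(** The level sets of kappa allow e = 0. There the eigenvalues have product 1, so kappa is 0 and
    that point lies in no level n >= 1. *)
Lemma attracting_cycles_unit_det (F : realType) (pr : params F) (X Y : word) :
  deltaL pr = 1 -> deltaR pr = 1 -> attracting_cycles pr X Y = set0.
Proof.
move=> hL hR; apply/seteqP; split => // -[k z] /= [_ [_ _ _ /eigenvalueC_lt1_det]].
by rewrite det_Mword1 // ltxx.
Qed.

Theorem theorem5p5 (F : realType) (m : F) (tL dL tR dR : F -> F) (X Y : word)
  (alpha beta : F) :
  let P := fun e : F => Params (tL e) (dL e) (tR e) (dR e) m in
  m != 0 ->
  smooth_near0 tL -> smooth_near0 dL -> smooth_near0 tR -> smooth_near0 dR ->
  primitive X -> first_letters_differ X Y ->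
  infinite_set [set k : nat | (1 <= k)%N /\ exists z : 'cV[F]_2,
    unique_cycle (P 0) (powcat X Y k) z /\
    stable_cycle (P 0) (powcat X Y k) z] ->
  repeated_unit_eigenvalue_geom1 (Mword (P 0) X) ->
  dL 0 = 1 -> dR 0 = 1 ->
  (forall B : F, \forall k \near \oo, forall z : 'cV[F]_2,
    unique_cycle (P 0) (powcat X Y k) z ->
    forall i : nat, (i < size (powcat X Y k))%N ->
    B <= `|cycle_x (P 0) (powcat X Y k) z i|) ->
  (fun e : F => \det (Mword (P e) X) - (1 + alpha * e))
    =O_ (0 : F) (fun e : F => e ^+ 2) ->
  (fun e : F => \tr (Mword (P e) X) - (2 + beta * e))
    =O_ (0 : F) (fun e : F => e ^+ 2) ->
  beta < alpha -> alpha < 0 ->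
  exists2 estar : F, 0 < estar &
  infinite_set (eps_defined P X Y estar) /\
  exists (phi : nat -> F) (c C : F),
    [/\ 0 < c, forall n : nat, (1 <= n)%N -> c <= phi n <= C &
        asymp_equiv (eps_defined P X Y estar) (eps P X Y estar)
          (fun n => phi n * n%:R ^- 2)].
Proof.
move=> P _ /smooth_derivable htL /smooth_derivable hdL /smooth_derivable htR
  /smooth_derivable hdR [Xnil _] _ hinf hM dL0 dR0 hmin hdet htr hba ha.
have X0 : (0 < size X)%N by rewrite lt0n; apply/negP => /nilP.
have [trM0 detM0] := repeated_tr_det hM.
have [b hB] := unperturbed_structure (pr := P 0) dL0 dR0 hM hinf.
have good := large_cycles_unperturbed X0 hM hinf hB hmin.
have qdet := bigO_sqr_linear hdet; have qtr := bigO_sqr_linear htr.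
have hd : (1 - \det (Mword (P e) X)) / e @[e --> 0^'] --> - alpha.
  have -> : (fun e => (1 - \det (Mword (P e) X)) / e)
      = (fun e => - ((\det (Mword (P e) X) - 1) / e)).
    by apply/funext => e; rewrite -mulNr opprB.
  exact: cvgN qdet.
have hs : (1 - \tr (Mword (P e) X) + \det (Mword (P e) X)) / e @[e --> 0^']
    --> alpha - beta.
  have -> : (fun e => (1 - \tr (Mword (P e) X) + \det (Mword (P e) X)) / e)
      = (fun e => (\det (Mword (P e) X) - 1) / e - (\tr (Mword (P e) X) - 2) / e).
    by apply/funext => e; rewrite -mulrBl; congr (_ / _); ring.
  exact: cvgB qdet qtr.
have a0 : 0 < alpha - beta by rewrite subr_gt0.
have b0 : 0 < - alpha by rewrite oppr_gt0.
have [k0 [c [c0 hlo]]] :=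
  attracting_exists htL hdL htR hdR X0 a0 b0 hs hd trM0 detM0 hB good.
have [e1 [C [e10 C0 hup]]] :=
  admissible_bound htL hdL htR hdR X0 a0 hs hd trM0 detM0 hB good.
have [estar [lo [hi [estar0 lo0 hk]]]] :=
  @kappa_bounds F P X Y k0 c e1 C c0 e10 C0 hlo hup.
exists estar => //.
have level n e : (1 <= n)%N -> kappa_level P X Y estar n e ->
    0 < e /\ lo <= n%:R ^+ 2 * e <= hi.
  move=> n1 [/andP[e0 ee] hn].
  have epos : 0 < e.
    rewrite lt_neqAle e0 andbT eq_sym; apply/eqP => ez; move: hn; rewrite ez /kappa_is.
    rewrite attracting_cycles_unit_det // card_eq_sym card_eq0 => /eqP h.
    by have : `I_n 0%N by []; rewrite h.
  have [n' [hn' _ hb]] := hk e (introT andP (conj epos ee)).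
  have := card_eq_trans (_ : (`I_n #= attracting_cycles (P e) X Y)%card) hn'.
  by rewrite card_eq_sym hn => /(_ isT)/card_eq_II ->.
have epsb n : eps_defined P X Y estar n ->
    lo <= n%:R ^+ 2 * eps P X Y estar n <= hi.
  move=> [n1 hn]; have nR : 0 < n%:R ^+ 2 :> F by rewrite exprn_gt0 // ltr0n.
  have ub : ubound (kappa_level P X Y estar n) (hi / n%:R ^+ 2).
    move=> e he; have [_ /andP[_ h]] := level n e n1 he.
    by rewrite ler_pdivlMr // mulrC.
  apply/andP; split; last first.
    by rewrite mulrC -ler_pdivlMr //; apply: ge_sup.
  have [e he] := hn; have [_ /andP[h _]] := level n e n1 he.
  apply: (le_trans h); rewrite ler_pM2l //.
  by apply: ub_le_sup => //; exists (hi / n%:R ^+ 2).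
have lohi : lo <= hi.
  have [|n [_ _ /andP[h1 h2]]] := hk estar; first by rewrite estar0 lexx.
  exact: le_trans h1 h2.
split.
  apply: unbounded_infinite => K.
  (* For this e, n = kappa(e) satisfies (K + 1)^2 e <= lo <= n^2 e, so a value beyond K is
     attained. *)
  pose e := Num.min estar (lo / K.+1%:R ^+ 2).
  have KR : 0 < K.+1%:R ^+ 2 :> F by rewrite exprn_gt0 // ltr0n.
  have e0 : 0 < e by rewrite lt_min estar0 divr_gt0.
  have ee : e <= estar by rewrite ge_min lexx.
  have [n [hn n1 /andP[h _]]] := hk e (introT andP (conj e0 ee)).
  exists n; last by split=> //; exists e; split=> //; rewrite (ltW e0).
  have eK : K.+1%:R ^+ 2 * e <= lo.
    by rewrite mulrC -ler_pdivlMr // ge_min lexx orbT.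
  have : K.+1%:R ^+ 2 <= n%:R ^+ 2 :> F by rewrite -(ler_pM2r e0) (le_trans eK).
  by rewrite ler_pXn2r ?nnegrE // ler_nat => /ltnW.
(* With this choice the quotient is exactly 1 wherever the supremum is defined. The default [lo]
   keeps phi within the bounds at the skipped values, by [lohi]. *)
pose phi n := if `[< eps_defined P X Y estar n >]
  then n%:R ^+ 2 * eps P X Y estar n else lo.
exists phi, lo, hi; split=> //.
  by move=> n _; rewrite /phi; case: asboolP => [/epsb//|_]; rewrite lexx.
apply: cvg_near_cst; rewrite near_withinE; apply: nearW => n hn.
have /andP[h _] := epsb n hn; rewrite /phi; case: asboolP => // _.
have nR : n%:R != 0 :> F by rewrite pnatr_eq0 -lt0n; case: hn.
have h0 : eps P X Y estar n != 0.
  by apply: contraTneq h => ->; rewrite mulr0 -ltNge.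
by field; rewrite h0 nR.
Qed.
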